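(* There are positive constants $M_n$ and $R_n$ such that whenever $T = (T_1, \ldots, T_n) \in \mathcal{B}(H)^n$ satisfies $\left\| \sum_{i=1}^n \zeta_i T_i \right\| \leq 1$ for all $\zeta_1,\dots,\zeta_n \in \overline{\mathbb{D}}$, and $p$ is a polynomial in $n$ variables, then \[ \|p^{\mathrm{sym}}(T)\| \leq \|p\|_{R_n \overline{\mathbb{D}}^n} \quad\text{and}\quad \|p^{\mathrm{sym}}(T)\| \leq M_n \|p\|_{\overline{\mathbb{D}}^n}. \] Moreover, one can choose $R_2 = 1.85$, $R_3 = 2.6$, $M_2 = 4.1$ and $M_3 = 16.6$.
   Context: $H$ is a Hilbert space, $\mathbb{D}$ the open unit disk, and $\|f\|_X$ the supremum of $|f|$ on $X$. The operators $T_i$ are not assumed to commute. For a polynomial $p$ in $n$ variables, $p^{\mathrm{sym}}(T)$ denotes the symmetrized evaluation of $p$ at $T$: each monomial $z^\alpha = z_1^{\alpha_1}\cdots z_n^{\alpha_n}$ is sent to the average, over all distinct orderings, of the ordered products of $|\alpha|$ operators containing exactly $\alpha_j$ factors equal to $T_j$ for each $j$ (the empty product being $I$), and this is extended linearly to all polynomials. *)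

(* Defs.v *)
From HB Require Import structures.
From mathcomp Require Import all_boot all_order all_algebra.
From mathcomp Require Import reals.
From mathcomp Require Import complex.
From mathcomp Require Import mpoly.
Set Implicit Arguments. Unset Strict Implicit. Unset Printing Implicit Defensive.
Import Order.TTheory GRing.Theory Num.Theory.
Local Open Scope ring_scope.

(* Scalars: C := R[i] (complex numbers over a real field R : realType). *)

(* A complex Hilbert space: a C-vector space V with an inner product
   ip (linear in the first argument, conjugate symmetric, positive definite)
   which is complete for the induced norm. *)
Definition is_hilbert (R : realType) (V : lmodType R[i]) (ip : V -> V -> R[i]) : Prop :=
  [/\ (forall (a : R[i]) (x y z : V), ip (a *: x + y) z = a * ip x z + ip y z),
      (forall x y : V, ip y x = (ip x y)^*),
      (forall x : V, 0 <= ip x x),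
      (forall x : V, ip x x = 0 -> x = 0) &
      (* completeness: every Cauchy sequence converges *)
      (forall u : nat -> V,
        (forall e : R[i], 0 < e -> exists N : nat, forall m k : nat,
            (N <= m)%N -> (N <= k)%N -> sqrtC (ip (u m - u k) (u m - u k)) < e) ->
        exists l : V, forall e : R[i], 0 < e -> exists N : nat, forall m : nat,
            (N <= m)%N -> sqrtC (ip (u m - l) (u m - l)) < e)].

(* the induced norm ||x|| = sqrt <x,x> *)
Definition hnorm (R : realType) (V : lmodType R[i]) (ip : V -> V -> R[i]) (x : V) : R[i] :=
  sqrtC (ip x x).

(* Ordered product T_{w_1} T_{w_2} ... T_{w_k} applied to x (empty product = I). *)
Definition word_apply (R : realType) (V : lmodType R[i]) (n : nat)
  (T : 'I_n -> V -> V) (w : seq 'I_n) (x : V) : V :=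
  foldr (fun i y => T i y) x w.

(* The distinct orderings of the monomial z^m: words of length |m| containing
   exactly m_j letters j for each j. *)
Definition orderings (n : nat) (m : 'X_{1..n}) : {set (mdeg m).-tuple 'I_n} :=
  [set w : (mdeg m).-tuple 'I_n | [forall j : 'I_n, count_mem j w == m j]].

(* Symmetrized evaluation of the monomial z^m at T: average over all distinct
   orderings of the ordered products. *)
Definition sym_monomial (R : realType) (V : lmodType R[i]) (n : nat)
  (T : 'I_n -> V -> V) (m : 'X_{1..n}) (x : V) : V :=
  (#|orderings m|%:R)^-1 *: \sum_(w in orderings m) word_apply T w x.

(* p^sym(T), extended linearly to all polynomials. *)
Definition sym_eval (R : realType) (V : lmodType R[i]) (n : nat)
  (p : {mpoly R[i][n]}) (T : 'I_n -> V -> V) (x : V) : V :=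
  \sum_(m <- msupp p) p@_m *: sym_monomial T m x.

(* The bounds of the theorem for a given n and constants Mn, Rn:
   for every Hilbert space H, every n-tuple T of (linear) operators on H with
   || sum_i zeta_i T_i || <= 1 for all zeta in the closed polydisc, and every
   polynomial p,
     ||p^sym(T)|| <= ||p||_{Rn D^n}   and   ||p^sym(T)|| <= Mn ||p||_{D^n}.
   Operator norm bounds ||A|| <= c are written as  forall x, ||A x|| <= c ||x||;
   sup-norm bounds ||p|| <= c are quantified over all upper bounds c of |p| on
   the polydisc. *)
Definition sym_bounds (R : realType) (n : nat) (Mn Rn : R) : Prop :=
  forall (V : lmodType R[i]) (ip : V -> V -> R[i]), is_hilbert ip ->
  forall T : 'I_n -> V -> V,
    (forall i, linear (T i)) ->
    (forall zeta : 'I_n -> R[i], (forall i, `|zeta i| <= 1) ->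
       forall x : V, hnorm ip (\sum_(i < n) zeta i *: T i x) <= hnorm ip x) ->
  forall p : {mpoly R[i][n]},
    (forall c : R,
       (forall z : 'I_n -> R[i], (forall i, `|z i| <= (Rn%:C)%C) -> `|p.@[z]| <= (c%:C)%C) ->
       forall x : V, hnorm ip (sym_eval p T x) <= (c%:C)%C * hnorm ip x) /\
    (forall c : R,
       (forall z : 'I_n -> R[i], (forall i, `|z i| <= 1) -> `|p.@[z]| <= (c%:C)%C) ->
       forall x : V, hnorm ip (sym_eval p T x) <= ((Mn * c)%:C)%C * hnorm ip x).

(* Main.v *)
(** With [g a b := a! b! / (a+b)!], the number of orderings of [z^m] is the inverse
of the product over [k] of [g (m_0 + ... + m_(k-1)) m_k].  Put
[q := \sum_m p_m / #|orderings m| z^m].  For [zeta] on the torus,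
[A := \sum_i zeta_i T_i] is a contraction and [A^k] has [zeta^m]-coefficient
[#|orderings m|] times the symmetrized monomial, so the average over the torus of
[q (conj zeta)] against the (positive) Fejer kernel of [A] tends to [p^sym T];
hence [|p^sym T| <= sup |q|].

It remains to bound [sup |q|] by [sup |p|], that is, to represent the two-variable
multiplier [g] by a measure on the bidisc.  For any function [h] on [0, 1], the beta
integral and an integration by parts give, with [M := t^a (1-t)^b],
[g a b = (1 - h 1) 0^b + h 0 0^a + \int_0^1 (h' M + D_(h,1-h) M) dt].
For [h = 1 - t] Cauchy's estimate bounds the total mass by 4.  After a dilation by
[X, Y < 1], with [h 0 = 0] and [h 1 = 1], the integrand is a positive measure as soon
as [2 X h <= h' (1 - X^2 t^2)] and [2 Y (1-h) <= h' (1 - Y^2 (1-t)^2)], by the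
Schwarz-Pick lemma; the total mass is then 1. *)
Require Import Defs.
From HB Require Import structures.
From mathcomp Require Import all_boot all_order all_algebra.
From mathcomp Require Import cyclic separable cyclotomic.
From mathcomp Require Import reals.
From mathcomp Require Import complex.
From mathcomp Require Import mpoly.
From mathcomp Require Import ring lra zify.
Set Implicit Arguments. Unset Strict Implicit. Unset Printing Implicit Defensive.
Import Order.TTheory GRing.Theory Num.Theory.
Local Open Scope ring_scope.

(** * Averages over roots of unity *)

(** In characteristic zero [X^n - 1] is separable, so it has [n] distinct roots, and a full set of
    [n]-th roots of unity contains a primitive one. *)
Lemma prim_root_exists (F : numClosedFieldType) (n : nat) :
  (0 < n)%N -> {w : F | n.-primitive_root w}.
Proof.
move=> n0; apply: sigW; have mon : 'X^n - 1 \is @monic F by apply: monicXnsubC.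
have [rs] := closed_field_poly_normal ('X^n - 1 : {poly F}).
rewrite (monicP mon) scale1r => Ers.
suff /hasP[w _ wn] : has n.-primitive_root rs by exists w.
apply: has_prim_root => //.
- by apply/allP => w; rewrite -root_prod_XsubC -Ers.
- by rewrite -separable_prod_XsubC -Ers separable_Xn_sub_1 // pnatr_eq0 -lt0n.
- by rewrite -ltnS -(size_prod_XsubC rs id) -Ers size_XnsubC.
Qed.

Lemma norm_prim_root (F : numClosedFieldType) (L : nat) (w : F) (j : nat) :
  (0 < L)%N -> L.-primitive_root w -> `|w ^+ j| = 1.
Proof.
move=> L0 Hw; apply/eqP; rewrite -(@pexpr_eq1 _ _ L) // -normrX -exprM mulnC exprM.
by rewrite (prim_expr_order Hw) expr1n normr1.
Qed.

(** A geometric sum whose ratio [u] satisfies [u^L = 1], with [u = 1] exactly under the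
    congruence. *)
Lemma sum_prim_root (F : numClosedFieldType) (L : nat) (w : F) (e f : nat) :
  (0 < L)%N -> L.-primitive_root w ->
  \sum_(j < L) (w ^+ j) ^+ e * ((w ^+ j)^*) ^+ f = L%:R * (e == f %[mod L])%:R.
Proof.
move=> L0 Hw.
have w1 : `|w| = 1 by rewrite -(norm_prim_root 1 L0 Hw) expr1.
have ww : w * w^* = 1 by rewrite -normCK w1 expr1n.
pose u := w ^+ e * w^* ^+ f.
have -> : \sum_(j < L) (w ^+ j) ^+ e * ((w ^+ j)^*) ^+ f = \sum_(j < L) u ^+ j.
  apply: eq_bigr => j _; rewrite rmorphXn -!exprM /u exprMn -!exprM.
  by rewrite (mulnC j e) (mulnC j f).
have uw : u * w ^+ f = w ^+ e by rewrite /u -mulrA -exprMn mulrC (mulrC w^*) ww expr1n mul1r.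
have [ef|ef] := boolP (e == f %[mod L]).
  have u1 : u = 1.
    move: ef; rewrite -(eq_prim_root_expr Hw) => /eqP ef.
    by rewrite /u ef -exprMn ww expr1n.
  rewrite u1; under eq_bigr do rewrite expr1n.
  by rewrite sumr_const card_ord mulr1.
have u1 : u != 1.
  apply: contra ef => /eqP u1; rewrite -(eq_prim_root_expr Hw) -uw u1 mul1r //.
have uL : u ^+ L = 1.
  rewrite /u exprMn -!exprM mulnC exprM (prim_expr_order Hw) expr1n mul1r.
  by rewrite mulnC exprM -rmorphXn (prim_expr_order Hw) rmorph1 expr1n.
apply: (mulfI (_ : u - 1 != 0)); first by rewrite subr_eq0.
by rewrite -subrX1 uL subrr mulr0n !mulr0.
Qed.

(** * The Fejer form of a contraction *)

Lemma big_tuple_cons (M : nmodType) (I : finType) (k : nat) (F : k.+1.-tuple I -> M) :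
  \sum_w F w = \sum_i \sum_(w : k.-tuple I) F [tuple of i :: w].
Proof.
rewrite pair_big /=.
rewrite (reindex (fun p : I * k.-tuple I => [tuple of p.1 :: p.2])) //=.
exists (fun w : k.+1.-tuple I => (thead w, [tuple of behead w])) => [[i w] _|w _] /=.
  by rewrite theadE; congr pair; apply: val_inj.
by rewrite -tuple_eta.
Qed.

Lemma big_tuple_nil (M : nmodType) (I : finType) (F : 0.-tuple I -> M) :
  \sum_w F w = F [tuple].
Proof.
rewrite (bigD1 [tuple]) //= [X in _ + X]big1 ?addr0 // => w /eqP[].
exact: tuple0.
Qed.

Lemma prod_count (F : comNzRingType) (I : finType) (f : I -> F) (w : seq I) :
  \prod_(i <- w) f i = \prod_i f i ^+ count_mem i w.
Proof.
elim: w => [|a w IH]; first by rewrite big_nil big1.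
rewrite big_cons IH (bigD1 a) //= [RHS](bigD1 a) //= eqxx add1n exprS mulrA; congr (_ * _).
by apply: eq_bigr => i ia; rewrite eq_sym (negbTE ia).
Qed.

(** A grid of roots of unity stands in for Haar measure on the torus. It only sees exponents modulo
    [L], whence the degree bounds in the averages below. *)
Lemma sum_torus (F : numClosedFieldType) (n L : nat) (w : F) (al be : 'I_n -> nat) :
  (0 < L)%N -> L.-primitive_root w ->
  \sum_(e : {ffun 'I_n -> 'I_L})
     (\prod_i (w ^+ e i) ^+ be i) * \prod_i ((w ^+ e i)^*) ^+ al i
  = (L ^ n)%:R * [forall i, be i == al i %[mod L]]%:R.
Proof.
move=> L0 Hw.
under eq_bigr do rewrite -big_split /=.
rewrite -(bigA_distr_bigA (fun i (j : 'I_L) => (w ^+ j) ^+ be i * ((w ^+ j)^*) ^+ al i)).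
under eq_bigr do rewrite sum_prim_root //.
rewrite big_split /= prodr_const card_ord natrX; congr (_ * _).
case: (boolP [forall i, be i == al i %[mod L]]) => [/forallP H|].
  by rewrite big1 // => i _; rewrite (H i).
by rewrite negb_forall => /existsP [i Hi]; rewrite (bigD1 i) //= (negbTE Hi) mul0r.
Qed.

Section FejerForm.
Variables (F : numClosedFieldType) (V : lmodType F) (ip : V -> V -> F).
Hypothesis ipP : forall a x y z, ip (a *: x + y) z = a * ip x z + ip y z.
Hypothesis ipC : forall x y, ip y x = (ip x y)^*.
Hypothesis ip_ge0 : forall x, 0 <= ip x x.

Lemma ip0l z : ip 0 z = 0.
Proof. by have := ipP (-1) 0 0 z; rewrite scaler0 addr0 mulN1r addNr. Qed.
Lemma ipDl x y z : ip (x + y) z = ip x z + ip y z.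
Proof. by rewrite -{1}[x]scale1r ipP mul1r. Qed.
Lemma ipZl a x z : ip (a *: x) z = a * ip x z.
Proof. by rewrite -{1}[a *: x]addr0 ipP ip0l addr0. Qed.
Lemma ipDr x y z : ip z (x + y) = ip z x + ip z y.
Proof. by rewrite ipC ipDl rmorphD /= -!ipC. Qed.
Lemma ipZr a x z : ip z (a *: x) = a^* * ip z x.
Proof. by rewrite ipC ipZl rmorphM /= -ipC. Qed.
Lemma ip_suml (I : Type) (r : seq I) (P : pred I) (f : I -> V) z :
  ip (\sum_(i <- r | P i) f i) z = \sum_(i <- r | P i) ip (f i) z.
Proof. exact: (big_morph (fun x => ip x z) (fun x y => ipDl x y z) (ip0l z)). Qed.

(* The sum over [|k| < N] of [(N - |k|) <A^k x, y>], where [A^(-k)] stands for the adjoint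
   of [A^k]. *)
Definition fejer_form (A : V -> V) (N : nat) (x y : V) : F :=
  \sum_(m < N) (ip (\sum_(k < m.+1) iter k A x) y
                + ip x (\sum_(k < m.+1) iter k A y) - ip x y).

Section Fejer.
Variable A : V -> V.
Hypothesis linA : linear A.

Let psum m x := \sum_(k < m.+1) iter k A x.

Let AD x y : A (x + y) = A x + A y.
Proof. by rewrite -{1}[x]scale1r linA scale1r. Qed.
Let A0 : A 0 = 0.
Proof. by have := linA (-1) 0 0; rewrite scaler0 addr0 scaleN1r addNr. Qed.

Let iterP k a x y : iter k A (a *: x + y) = a *: iter k A x + iter k A y.
Proof. by elim: k => //= k ->; rewrite linA. Qed.

Let psumP m a x y : psum m (a *: x + y) = a *: psum m x + psum m y.
Proof.
rewrite /psum; under eq_bigr do rewrite iterP.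
by rewrite big_split /= scaler_sumr.
Qed.

Let psum0 x : psum 0 x = x. Proof. by rewrite /psum big_ord1. Qed.
Let psumS m x : psum m.+1 x = A (psum m x) + x.
Proof.
rewrite /psum big_ord_recl /= addrC; congr (_ + _).
by rewrite (big_morph A AD A0).
Qed.

Lemma fejer_formDl N a x y z :
  fejer_form A N (a *: x + y) z = a * fejer_form A N x z + fejer_form A N y z.
Proof.
rewrite /fejer_form mulr_sumr -big_split /=; apply: eq_bigr => m _.
by rewrite -/(psum m _) psumP !ipP -/(psum m _); ring.
Qed.

Lemma fejer_formC N x y : fejer_form A N y x = (fejer_form A N x y)^*.
Proof.
rewrite /fejer_form rmorph_sum /=; apply: eq_bigr => m _.
by rewrite rmorphB rmorphD /= -!ipC; ring.
Qed.

(* [2 Re <s_m, x> - |x|^2 = |s_m|^2 - |A s_(m-1)|^2] for the partial sums [s_m],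
   so the form telescopes. *)
Lemma fejer_form_ge0 N x : (forall x, ip (A x) (A x) <= ip x x) ->
  0 <= fejer_form A N x x.
Proof.
move=> contrA; case: N => [|N]; first by rewrite /fejer_form big_ord0.
suff: ip (psum N x) (psum N x) <= fejer_form A N.+1 x x by apply: le_trans.
elim: N => [|N IH].
  by rewrite /fejer_form big_ord1 -/(psum 0 x) psum0 addrK.
rewrite /fejer_form big_ord_recr /= -/(fejer_form A N.+1 x x).
apply: le_trans (lerD IH (lexx _)).
rewrite -/(psum N.+1 x) psumS !ipDl !ipDr.
rewrite -subr_ge0.
set u := psum N x; have := contrA u.
rewrite -subr_ge0; congr (_ <= _); ring.
Qed.

(** Positivity at [y - conj(u) x], with [u] the phase of the form at [(x, y)]. The arithmetic mean
    replaces the Cauchy-Schwarz product because it is linear in the form and can be averaged over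
    the torus. *)
Lemma fejer_form_le N x y (q c : F) : (forall x, ip (A x) (A x) <= ip x x) ->
  `|q| <= c ->
  `|q * fejer_form A N x y| <= c * ((fejer_form A N x x + fejer_form A N y y) / 2%:R).
Proof.
move=> contrA qc; rewrite normrM; apply: ler_pM => //.
set B := fejer_form A N; set f := B x y.
have [f0|f0] := eqVneq f 0.
  by rewrite f0 normr0 divr_ge0 ?addr_ge0 ?fejer_form_ge0.
pose u := f / `|f|.
have nf : `|f| != 0 by rewrite normr_eq0.
have uf : u^* * f = `|f|.
  by rewrite /u rmorphM /= fmorphV /= conj_normC mulrAC mulrC (mulrC f^*) -normCK expr2 mulKf.
have uu : u * u^* = 1 by rewrite -normCK /u normrM normfV normr_id divff // expr1n.
have H : 0 <= B (- u^* *: x + y) (- u^* *: x + y) by apply: fejer_form_ge0.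
rewrite -/f ler_pdivlMr ?ltr0n // -subr_ge0.
suff <- : B (- u^* *: x + y) (- u^* *: x + y) = B x x + B y y - `|f| * 2%:R by [].
have Br a b c' z : B z (a *: b + c') = a^* * B z b + B z c'.
  by rewrite /B fejer_formC fejer_formDl rmorphD rmorphM /= -!fejer_formC.
have uf' : u * f^* = `|f| by rewrite -uf -[in LHS](conjCK u) -rmorphM /= uf conj_normC.
have Byx : B y x = f^* by rewrite /B fejer_formC.
rewrite {1}/B fejer_formDl -/B !Br Byx -/f rmorphN /= conjCK.
transitivity ((u * u^*) * B x x + B y y - (u^* * f) - (u * f^*)); first by ring.
by rewrite uu uf uf'; ring.
Qed.
End Fejer.
End FejerForm.

(** * Torus averages of the Fejer form *)

Lemma mnm_le_mdeg (n : nat) (al : 'X_{1..n}) (i : 'I_n) : (al i <= mdeg al)%N.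
Proof. by rewrite mdegE (bigD1 i) //= leq_addr. Qed.

Lemma sum_count_mem (I : finType) (w : seq I) : (\sum_i count_mem i w = size w)%N.
Proof.
elim: w => [|a w IH] /=; first by rewrite big1.
rewrite big_split /= IH (bigD1 a) //= eqxx big1 ?addn0 // => i ia.
by rewrite eq_sym (negbTE ia).
Qed.

Section TorusAverage.
Variables (F : numClosedFieldType) (V : lmodType F) (ip : V -> V -> F).
Hypothesis ipP : forall a x y z, ip (a *: x + y) z = a * ip x z + ip y z.
Hypothesis ipC : forall x y, ip y x = (ip x y)^*.
Variables (n : nat) (T : 'I_n -> V -> V).
Hypothesis linT : forall i, linear (T i).

Definition pencil (z : 'I_n -> F) (x : V) : V := \sum_i z i *: T i x.

Let word (w : seq 'I_n) (x : V) : V := foldr (fun i y => T i y) x w.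

Definition sym_sum (al : 'X_{1..n}) (x : V) : V := \sum_(w in orderings al) word w x.

Let T0 i : T i 0 = 0.
Proof. by have := linT i (-1) 0 0; rewrite scaler0 addr0 scaleN1r addNr. Qed.
Let TD i x y : T i (x + y) = T i x + T i y.
Proof. by rewrite -{1}[x]scale1r linT scale1r. Qed.
Let TZ i a x : T i (a *: x) = a *: T i x.
Proof. by rewrite -{1}[a *: x]addr0 linT T0 addr0. Qed.

Lemma pencil_linear z : linear (pencil z).
Proof.
move=> a x y; rewrite /pencil scaler_sumr -big_split /=; apply: eq_bigr => i _.
by rewrite linT scalerDr !scalerA mulrC.
Qed.

Lemma iter_pencil k z x :
  iter k (pencil z) x
  = \sum_(w : k.-tuple 'I_n) (\prod_i z i ^+ count_mem i w) *: word w x.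
Proof.
elim: k => [|k IH] /=.
  by rewrite big_tuple_nil big1 ?scale1r.
rewrite big_tuple_cons {1}/pencil; apply: eq_bigr => i _.
rewrite IH (big_morph (T i) (@TD i) (T0 i)) scaler_sumr; apply: eq_bigr => w _ /=.
rewrite TZ scalerA; congr (_ *: _).
by rewrite -(prod_count z w) -(prod_count z (i :: w)) big_cons.
Qed.

Section Average.
Variables (L : nat) (w : F).
Hypothesis wL : L.-primitive_root w.

Let zeta (e : {ffun 'I_n -> 'I_L}) (i : 'I_n) : F := w ^+ e i.
Let chi (al : 'X_{1..n}) e : F := \prod_i ((zeta e i)^*) ^+ al i.

Let L0 : (0 < L)%N := prim_order_gt0 wL.

(** [chi al] extracts the [zeta^al] coefficient of the [k]-th power. All exponents are below [L], so
    congruent exponents are equal. *)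
Lemma avg_iter_l k (al : 'X_{1..n}) x y : (k < L)%N -> (mdeg al < L)%N ->
  \sum_e chi al e * ip (iter k (pencil (zeta e)) x) y
  = (L ^ n)%:R * ((k == mdeg al)%:R * ip (sym_sum al x) y).
Proof.
move=> kL dL.
under eq_bigr do rewrite iter_pencil (ip_suml ipP) mulr_sumr.
rewrite exchange_big /=.
under eq_bigr => u _ do under eq_bigr => e _ do rewrite (ipZl ipP) mulrCA (mulrA (\prod_(_ | _) _)).
under eq_bigr => u _ do rewrite -mulr_suml (sum_torus al (fun i => count_mem i u)) //.
have E (u : k.-tuple 'I_n) : [forall i, count_mem i u == al i %[mod L]]
    = [forall i, count_mem i u == al i].
  apply: eq_forallb => i; rewrite !modn_small //.
    by rewrite (leq_ltn_trans _ dL) // mnm_le_mdeg.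
  by rewrite (leq_ltn_trans _ kL) // -[leqRHS](size_tuple u) count_size.
under eq_bigr => u _ do rewrite E -mulrA.
rewrite -mulr_sumr; congr (_ * _).
case: eqP => [ek|nk].
  rewrite mul1r; subst k; rewrite (ip_suml ipP) [RHS]big_mkcond /=.
  by apply: eq_bigr => u _; rewrite inE; case: ifP; rewrite ?mul1r ?mul0r.
rewrite mul0r big1 // => u _; case: forallP => [H|]; last by rewrite mul0r.
case: nk; rewrite -(size_tuple u) -sum_count_mem mdegE.
by apply: eq_bigr => i _; apply/eqP/H.
Qed.

(** In the second slot the powers contribute conjugates of [zeta], as [chi al] does. Nothing can
    cancel, so only the constant mode survives. *)
Lemma avg_iter_r k (al : 'X_{1..n}) x y : (mdeg al + k < L)%N ->
  \sum_e chi al e * ip x (iter k (pencil (zeta e)) y)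
  = (L ^ n)%:R * (((al == 0%MM) && (k == 0%N))%:R * ip x y).
Proof.
move=> dkL.
under eq_bigr do rewrite ipC iter_pencil (ip_suml ipP) rmorph_sum mulr_sumr /=.
rewrite exchange_big /=.
have E e (u : k.-tuple 'I_n) :
   chi al e * (ip ((\prod_i zeta e i ^+ count_mem i u) *: word u y) x)^*
   = (\prod_i (zeta e i) ^+ 0) * (\prod_i ((zeta e i)^*) ^+ (al i + count_mem i u))
     * (ip (word u y) x)^*.
  rewrite (ipZl ipP) rmorphM /= rmorph_prod mulrA; congr (_ * _).
  rewrite [X in _ = X * _]big1 // mul1r /chi -big_split /=; apply: eq_bigr => i _.
  by rewrite exprD; congr (_ * _); rewrite [LHS]rmorphXn.
under eq_bigr => u _ do under eq_bigr => e _ do rewrite E.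
under eq_bigr => u _ do
  rewrite -mulr_suml (sum_torus (fun i => al i + count_mem i u)%N (fun=> 0%N)) // -mulrA.
rewrite -mulr_sumr; congr (_ * _).
have E2 (u : k.-tuple 'I_n) : [forall i, 0%N == (al i + count_mem i u)%N %[mod L]]
    = (al == 0%MM) && (k == 0%N).
  apply/forallP/andP => [H|[/eqP -> /eqP k0] i]; last first.
    by subst k; rewrite (tuple0 u) mnm0E.
  have H' i : (al i + count_mem i u = 0)%N.
    move: (H i); rewrite mod0n modn_small ?(eq_sym 0%N) => [/eqP //|].
    apply: leq_ltn_trans dkL; rewrite leq_add ?mnm_le_mdeg //.
    by rewrite -[leqRHS](size_tuple u) count_size.
  split.
    by apply/eqP/mnmP => i; rewrite mnm0E; move: (H' i) => /eqP; rewrite addn_eq0 => /andP[/eqP].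
  rewrite -(size_tuple u) -sum_count_mem big1 // => i _.
  by move: (H' i) => /eqP; rewrite addn_eq0 => /andP[_ /eqP].
under eq_bigr => u _ do rewrite E2.
case: andP => [[_ /eqP k0]|_]; last by rewrite mul0r big1 // => u _; rewrite mul0r.
by subst k; rewrite big_tuple_nil !mul1r -ipC.
Qed.

(** The [m]-th summand of the form contributes once [mdeg al <= m], which happens for [N - mdeg al]
    values of [m]. The adjoint part leaves only its constant mode, cancelled by the subtracted
    [ip x y]. *)
Lemma avg_fejer N (al : 'X_{1..n}) x y : (mdeg al <= N)%N -> (N + N < L)%N ->
  \sum_e chi al e * fejer_form ip (pencil (zeta e)) N x y
  = (L ^ n)%:R * ((N - mdeg al)%:R * ip (sym_sum al x) y).
Proof.
move=> dN NL.
have chi1 : \sum_e chi al e * ip x y = (L ^ n)%:R * ((al == 0%MM)%:R * ip x y).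
  have := @avg_iter_r 0 al x y; rewrite addn0 eqxx andbT; apply.
  by apply: leq_ltn_trans NL; rewrite (leq_trans dN) // leq_addr.
have E (m : 'I_N) : \sum_e chi al e * (ip (\sum_(k < m.+1) iter k (pencil (zeta e)) x) y
     + ip x (\sum_(k < m.+1) iter k (pencil (zeta e)) y) - ip x y)
  = (L ^ n)%:R * ((mdeg al <= m)%:R * ip (sym_sum al x) y).
  under eq_bigr do rewrite mulrBr mulrDr.
  rewrite big_split big_split sumrN /= chi1.
  under eq_bigr do rewrite (ip_suml ipP) mulr_sumr.
  rewrite exchange_big /=.
  under eq_bigr => k _.
    rewrite avg_iter_l; [over| |].
      by apply: leq_ltn_trans NL; rewrite (leq_trans _ (leq_addr _ _)) // (leq_trans _ (ltn_ord m)) // ltnW.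
    by apply: leq_ltn_trans NL; rewrite (leq_trans dN) // leq_addr.
  under [X in _ + X - _]eq_bigr do rewrite ipC (ip_suml ipP) rmorph_sum mulr_sumr /=.
  rewrite [X in _ + X - _]exchange_big /=.
  under [X in _ + X - _]eq_bigr => k _.
    under eq_bigr do rewrite -ipC.
    rewrite avg_iter_r; first over.
    apply: leq_ltn_trans NL; rewrite leq_add //.
    by rewrite -ltnS (leq_trans (ltn_ord k)) // ltnS ltnW.
  rewrite -!mulr_sumr -!mulr_suml.
  have -> : \sum_(i < m.+1) (((al == 0%MM) && (nat_of_ord i == 0%N))%:R : F) = (al == 0%MM)%:R.
    by rewrite big_ord_recl /= eqxx andbT big1 ?addr0 // => i _; rewrite andbF.
  rewrite addrK; congr (_ * (_ * _)).
  case: leqP => dm.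
    rewrite (bigD1 (Ordinal (dm : (mdeg al < m.+1)%N))) //= eqxx big1 ?addr0 // => i.
    by rewrite -val_eqE /= => /negbTE ->.
  rewrite big1 // => i _; case: eqP => // ei.
  by move: (ltn_ord i); rewrite ei ltnS leqNgt dm.
under eq_bigr do rewrite /fejer_form mulr_sumr.
rewrite exchange_big /=; under eq_bigr do rewrite E.
rewrite -mulr_sumr -mulr_suml; congr (_ * (_ * _)).
rewrite -natr_sum; congr (_%:R).
rewrite -(big_mkord xpredT (fun m => nat_of_bool (mdeg al <= m)%N)) (big_cat_nat (leq0n _) dN) /=.
rewrite big_nat big1 => [|i /andP[_ il]]; last by rewrite leqNgt il.
rewrite add0n big_nat (eq_bigr (fun=> 1%N)) => [|i /andP[-> _]] //.
by rewrite -big_nat sum_nat_const_nat muln1.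
Qed.
End Average.
End TorusAverage.

(** * Reduction to a multiplier estimate *)

Definition mscale (F : nzRingType) (n : nat) (mu : 'X_{1..n} -> F) (p : {mpoly F[n]}) :
  {mpoly F[n]} := \sum_(m <- msupp p) (p@_m * mu m) *: 'X_[m].

Lemma mcoeff_mscale (F : nzRingType) (n : nat) (mu : 'X_{1..n} -> F) (p : {mpoly F[n]}) m :
  (mscale mu p)@_m = p@_m * mu m.
Proof.
rewrite /mscale raddf_sum /=; under eq_bigr do rewrite mcoeffZ mcoeffX.
have [mp|mp] := boolP (m \in msupp p).
  rewrite (big_rem m) //= eqxx mulr1 big_seq big1 ?addr0 // => k.
  by rewrite mem_rem_uniq // inE => /andP[/negbTE -> _]; rewrite mulr0.
rewrite (memN_msupp_eq0 mp) mul0r big_seq big1 // => k kp.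
by case: eqP => [km|_]; rewrite ?mulr0 //; move: mp; rewrite -km kp.
Qed.

Lemma mscaleM (F : nzRingType) (n : nat) (mu nu : 'X_{1..n} -> F) (p : {mpoly F[n]}) :
  mscale (fun m => mu m * nu m) p = mscale nu (mscale mu p).
Proof. by apply/mpolyP => m; rewrite !mcoeff_mscale mulrA. Qed.

Lemma eq_mscale (F : nzRingType) (n : nat) (mu nu : 'X_{1..n} -> F) (p : {mpoly F[n]}) :
  mu =1 nu -> mscale mu p = mscale nu p.
Proof. by move=> E; apply/mpolyP => m; rewrite !mcoeff_mscale E. Qed.

Lemma meval_mscale (F : comNzRingType) (n : nat) (mu : 'X_{1..n} -> F) (p : {mpoly F[n]}) z :
  (mscale mu p).@[z] = \sum_(m <- msupp p) p@_m * mu m * \prod_i z i ^+ m i.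
Proof.
by rewrite /mscale raddf_sum /=; apply: eq_bigr => m _; rewrite mevalZ mevalX.
Qed.

(** Division by [N] makes the fixed error [e] vanish in the limit. *)
Lemma archimedean_le (R : realType) (a b e : R) (D : nat) :
  (forall N : nat, (D <= N)%N -> N%:R * a <= N%:R * b + e) -> a <= b.
Proof.
move=> H; rewrite leNgt; apply/negP => ba.
have d0 : 0 < a - b by rewrite subr_gt0.
pose N := maxn D (Num.bound (`|e| / (a - b))).
have := H N (leq_maxl _ _); rewrite -lerBlDl -mulrBr leNgt => /negP; apply.
apply: le_lt_trans (ler_norm e) _; rewrite -ltr_pdivrMr //.
apply: lt_le_trans (archi_boundP _) _; first by rewrite divr_ge0 // ltW.
by rewrite ler_nat leq_maxr.
Qed.

Lemma archimedean_lec (R : realType) (a b e : R[i]) (D : nat) :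
  0 <= a -> 0 <= b -> 0 <= e ->
  (forall N : nat, (D <= N)%N -> N%:R * a <= N%:R * b + e) -> a <= b.
Proof.
move=> /ger0_real/RRe_real <- /ger0_real/RRe_real <- /ger0_real/RRe_real <- H.
rewrite lecR; apply: (@archimedean_le R _ _ (complex.Re e) D) => N /H.
by rewrite -!(rmorph_nat (real_complex R)) -!rmorphM -rmorphD /= lecR.
Qed.

(** The torus average of [q] against the Fejer form is [N <u, y> - E] with [E] independent of [N],
    and [fejer_form_le] bounds it by [N K (|x|^2 + |y|^2) / 2]. Large [N] gives [weak], from which
    the norm bound follows by a choice of [y]. *)
Lemma sym_eval_le (R : realType) (V : lmodType R[i]) (ip : V -> V -> R[i])
  (n : nat) (T : 'I_n -> V -> V) (p : {mpoly R[i][n]}) (K : R) :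
  is_hilbert ip -> (forall i, linear (T i)) ->
  (forall zeta : 'I_n -> R[i], (forall i, `|zeta i| <= 1) ->
     forall x, hnorm ip (\sum_(i < n) zeta i *: T i x) <= hnorm ip x) ->
  (forall z : 'I_n -> R[i], (forall i, `|z i| <= 1) ->
     `|(mscale (fun m => (#|orderings m|%:R)^-1) p).@[z]| <= (K%:C)%C) ->
  forall x, hnorm ip (sym_eval p T x) <= (K%:C)%C * hnorm ip x.
Proof.
move=> [ipP ipC ip_ge0 _ _] linT contrT qK x.
set Kc := (K%:C)%C in qK *.
have K0 : 0 <= Kc by apply: le_trans (qK (fun=> 0) _) => // i; rewrite normr0.
set u := sym_eval p T x.
have weak y : `|ip u y| <= Kc * ((ip x x + ip y y) / 2%:R).
  pose E := \sum_(m <- msupp p) p@_m * (#|orderings m|%:R)^-1 * (mdeg m)%:R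
     * ip (sym_sum T m x) y.
  have rhs0 : 0 <= Kc * ((ip x x + ip y y) / 2%:R).
    by rewrite mulr_ge0 // divr_ge0 // addr_ge0.
  apply: (@archimedean_lec R _ _ `|E| (msize p)) => // N pN.
  have [w wL] := @prim_root_exists R[i] (N + N).+1 isT.
  set L := (N + N).+1 in wL.
  pose zeta (e : {ffun 'I_n -> 'I_L}) (i : 'I_n) : R[i] := w ^+ e i.
  pose chi (al : 'X_{1..n}) e : R[i] := \prod_i ((zeta e i)^*) ^+ al i.
  have nz e i : `|zeta e i| = 1 by apply: (norm_prim_root _ _ wL).
  have z1 e i : `|zeta e i| <= 1 by rewrite nz.
  have contrA e y' : ip (pencil T (zeta e) y') (pencil T (zeta e) y') <= ip y' y'.
    have := contrT (zeta e) (z1 e) y'.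
    by rewrite /hnorm ler_sqrtC ?nnegrE.
  pose q e := \sum_(m <- msupp p) p@_m * (#|orderings m|%:R)^-1 * chi m e.
  (* The characters [chi] are monomials in the conjugates, so [q e] is a value of the rescaled
     polynomial at a point of the torus. *)
  have qe e : `|q e| <= Kc.
    have := qK (fun i => (zeta e i)^*) _; rewrite meval_mscale; apply => i.
    by rewrite norm_conjC nz.
  have Ln : 0 < (L ^ n)%:R :> R[i] by rewrite ltr0n expn_gt0.
  have main : \sum_e q e * fejer_form ip (pencil T (zeta e)) N x y
     = (L ^ n)%:R * (N%:R * ip u y - E).
    under eq_bigr do rewrite /q mulr_suml.
    rewrite exchange_big /=.
    have Em m : m \in msupp p ->
        \sum_e p@_m * (#|orderings m|%:R)^-1 * chi m e
           * fejer_form ip (pencil T (zeta e)) N x y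
        = (L ^ n)%:R * (N%:R * (p@_m * (#|orderings m|%:R)^-1 * ip (sym_sum T m x) y)
           - p@_m * (#|orderings m|%:R)^-1 * (mdeg m)%:R * ip (sym_sum T m x) y).
      move=> mp; under eq_bigr do rewrite -mulrA.
      have mN : (mdeg m <= N)%N by rewrite (leq_trans _ pN) // ltnW // msize_mdeg_lt.
      rewrite -mulr_sumr (avg_fejer ipP ipC linT wL _ _ mN) // natrB //.
      by ring.
    rewrite big_seq (eq_bigr _ Em) -big_seq -mulr_sumr sumrB -mulr_sumr -/E.
    congr (_ * (_ * _ - _)).
    rewrite /u /sym_eval (ip_suml ipP); apply: eq_bigr => m _.
    by rewrite (ipZl ipP) /sym_monomial (ipZl ipP) mulrA.
  (* The case [al = 0] of [avg_fejer]; comparison with [avg_iter_l] at [k = 0] identifies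
     [ip (sym_sum T 0 y') y'] with [ip y' y']. *)
  have diag y' : \sum_e fejer_form ip (pencil T (zeta e)) N y' y'
      = (L ^ n)%:R * (N%:R * ip y' y').
    have chi0 (e : {ffun 'I_n -> 'I_L}) : \prod_i ((w ^+ e i)^*) ^+ (0%MM : 'X_{1..n}) i = 1.
      by rewrite big1 // => i _; rewrite mnm0E.
    have d0 : (mdeg (0%MM : 'X_{1..n}) <= N)%N by rewrite mdeg0.
    have d1 : (mdeg (0%MM : 'X_{1..n}) < L)%N by rewrite mdeg0.
    have := avg_fejer ipP ipC linT wL y' y' d0 (ltnSn _).
    have := avg_iter_l ipP linT wL y' y' (ltn0Sn _ : (0 < L)%N) d1.
    rewrite mdeg0 subn0.
    under eq_bigr do rewrite chi0 mul1r.
    rewrite /= sumr_const card_ffun !card_ord -[LHS]mulr_natl mul1r.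
    move=> /(mulfI (lt0r_neq0 Ln)) <-.
    by move=> <-; apply: eq_bigr => e _; rewrite chi0 mul1r.
  have : `|(L ^ n)%:R * (N%:R * ip u y - E)|
      <= (L ^ n)%:R * (N%:R * (Kc * ((ip x x + ip y y) / 2%:R))).
    rewrite -main; apply: le_trans (ler_norm_sum _ _ _) _.
    have -> : (L ^ n)%:R * (N%:R * (Kc * ((ip x x + ip y y) / 2%:R)))
      = \sum_e Kc * ((fejer_form ip (pencil T (zeta e)) N x x
                + fejer_form ip (pencil T (zeta e)) N y y) / 2%:R).
      by rewrite -mulr_sumr -mulr_suml big_split /= !diag; field.
    apply: ler_sum => e _.
    exact: (fejer_form_le ipP ipC ip_ge0 (pencil_linear linT _)).
  rewrite normrM (ger0_norm (ltW Ln)) ler_pM2l // => H.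
  have -> : N%:R * `|ip u y| = `|N%:R * ip u y - E + E|.
    by rewrite subrK normrM normr_nat.
  by apply: le_trans (ler_normD _ _) _; rewrite lerD2r.
have uu : ip u u <= Kc ^+ 2 * ip x x.
  have [K00|K00] := eqVneq Kc 0.
    have := weak u; rewrite K00 mul0r expr0n /= mul0r.
    by apply: le_trans; rewrite ger0_norm.
  (* [y = u / K] is the optimal multiple of [u]: after multiplication by [2 K], one copy of [|u|^2]
     cancels and [|u|^2 <= K^2 |x|^2] is left. *)
  have := weak (Kc^-1 *: u).
  have KJ : (Kc^-1)^* = Kc^-1 by rewrite geC0_conj // invr_ge0.
  rewrite (ipZl ipP) !(ipZr ipP ipC) KJ normrM [`|Kc^-1|]ger0_norm ?invr_ge0 //.
  rewrite ger0_norm // => H.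
  have Kp : 0 < Kc by rewrite lt_def K00.
  have : 2 * Kc * (Kc^-1 * ip u u) <= 2 * Kc * (Kc * ((ip x x + Kc^-1 * (Kc^-1 * ip u u)) / 2)).
    by rewrite ler_pM2l // mulr_gt0.
  have -> : 2 * Kc * (Kc^-1 * ip u u) = ip u u + ip u u by field.
  have -> : 2 * Kc * (Kc * ((ip x x + Kc^-1 * (Kc^-1 * ip u u)) / 2))
     = Kc ^+ 2 * ip x x + ip u u by field.
  by rewrite lerD2r.
rewrite /hnorm -[Kc](sqrCK K0) -sqrtCM ?nnegrE ?exprn_ge0 //.
by rewrite ler_sqrtC ?nnegrE ?mulr_ge0 ?exprn_ge0.
Qed.

(** * Multipliers and moments of measures on the bidisc *)

(** The norm of a coefficient multiplier on the polydisc algebra, stated through upper bounds [c]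
    instead of suprema. *)
Definition mult_norm_le (R : realType) (n : nat) (B : R) (mu : 'X_{1..n} -> R[i]) : Prop :=
  forall (p : {mpoly R[i][n]}) (c : R),
    (forall z : 'I_n -> R[i], (forall i, `|z i| <= 1) -> `|p.@[z]| <= (c%:C)%C) ->
    forall z : 'I_n -> R[i], (forall i, `|z i| <= 1) ->
      `|(mscale mu p).@[z]| <= ((B * c)%:C)%C.

Lemma mult_norm_leM (R : realType) (n : nat) (B1 B2 : R) (mu nu : 'X_{1..n} -> R[i]) :
  mult_norm_le B1 mu -> mult_norm_le B2 nu ->
  mult_norm_le (B2 * B1) (fun m => mu m * nu m).
Proof.
move=> H1 H2 p c pc z z1; rewrite mscaleM -mulrA.
by apply: H2 z1 => z' z1'; apply: H1 z1'.
Qed.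

Lemma eq_mult_norm_le (R : realType) (n : nat) (B : R) (mu nu : 'X_{1..n} -> R[i]) :
  mu =1 nu -> mult_norm_le B mu -> mult_norm_le B nu.
Proof. by move=> E H p c pc z z1; rewrite -(eq_mscale _ E); apply: H z1. Qed.

Lemma mult_norm_le1 (R : realType) (n : nat) : mult_norm_le (1 : R) (fun _ : 'X_{1..n} => 1).
Proof.
move=> p c pc z z1; rewrite mul1r (_ : mscale _ p = p) ?pc //.
by apply/mpolyP => m; rewrite mcoeff_mscale mulr1.
Qed.

Lemma mult_norm_le_prod (R : realType) (n k : nat) (B : nat -> R)
    (mu : nat -> 'X_{1..n} -> R[i]) :
  (forall j, (j < k)%N -> mult_norm_le (B j) (mu j)) ->
  mult_norm_le (\prod_(j < k) B j) (fun m => \prod_(j < k) mu j m).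
Proof.
elim: k => [|k IH] H.
  rewrite big_ord0; apply: eq_mult_norm_le (@mult_norm_le1 R n) => m.
  by rewrite big_ord0.
rewrite big_ord_recr /= mulrC.
apply: (@eq_mult_norm_le _ _ _ (fun m => (\prod_(j < k) mu j m) * mu k m)) => [m|].
  by rewrite big_ord_recr.
by apply: mult_norm_leM; [apply: IH => j jk; apply: H; apply: ltnW | apply: H].
Qed.

(* [B] bounds the total mass of a complex measure on the closed bidisc whose moments are
   [m a b]; the measure is only given through its finitely supported approximations. *)
Definition char_hull (R : realType) (B : R) (m : nat -> nat -> R[i]) : Prop :=
  forall (D : nat) (e : R), 0 < e -> exists s : seq (R[i] * (R[i] * R[i])),
    [/\ all (fun t => (`|t.2.1| <= 1) && (`|t.2.2| <= 1)) s,
        \sum_(t <- s) `|t.1| <= ((B + e)%:C)%C &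
        forall a b, (a <= D)%N -> (b <= D)%N ->
          `|m a b - \sum_(t <- s) t.1 * (t.2.1 ^+ a * t.2.2 ^+ b)| <= (e%:C)%C].

Section CharHull.
Variable R : realType.
Implicit Types (B : R) (m : nat -> nat -> R[i]).

Lemma char_hull_finite (s : seq (R[i] * (R[i] * R[i]))) B m :
  all (fun t => (`|t.2.1| <= 1) && (`|t.2.2| <= 1)) s ->
  \sum_(t <- s) `|t.1| <= (B%:C)%C ->
  (forall a b, m a b = \sum_(t <- s) t.1 * (t.2.1 ^+ a * t.2.2 ^+ b)) ->
  char_hull B m.
Proof.
move=> s1 sB sm D e e0; exists s; split=> // [|a b _ _].
  by apply: le_trans sB _; rewrite lecR lerDl ltW.
by rewrite sm subrr normr0 ler0c ltW.
Qed.

Lemma char_hull_char (l u : R[i]) : `|l| <= 1 -> `|u| <= 1 ->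
  char_hull 1 (fun a b => l ^+ a * u ^+ b).
Proof.
move=> l1 u1; apply: (@char_hull_finite [:: (1, (l, u))]); rewrite /= ?l1 ?u1 //.
  by rewrite big_seq1 normr1.
by move=> a b; rewrite big_seq1 mul1r.
Qed.

(** Closure under limits, for Riemann sums and truncated Moebius maps: half of [e] pays for
    replacing [m] by [m'], half for the atoms approximating [m']. *)
Lemma char_hull_lim B m :
  (forall (D : nat) (e : R), 0 < e -> exists B' m', [/\ char_hull B' m', B' <= B + e &
     forall a b, (a <= D)%N -> (b <= D)%N -> `|m a b - m' a b| <= (e%:C)%C]) ->
  char_hull B m.
Proof.
move=> H D e e0; have e2 : 0 < e / 2 by rewrite divr_gt0.
have [B' [m' [Hm' B'B mm']]] := H D _ e2.
have [s [s1 sB sm]] := Hm' D _ e2; exists s; split=> //.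
  by apply: le_trans sB _; rewrite lecR [X in _ <= B + X](splitr e) addrA lerD2r.
move=> a b aD bD; rewrite -(subrKA (m' a b)) (splitr e) rmorphD.
by apply: le_trans (ler_normD _ _) _; rewrite lerD ?mm' ?sm.
Qed.

Lemma eq_char_hull B m m' : (forall a b, m a b = m' a b) -> char_hull B m -> char_hull B m'.
Proof.
move=> E H; apply: char_hull_lim => D e e0; exists B, m; split=> // [|a b _ _].
  by rewrite lerDl ltW.
by rewrite E subrr normr0 ler0c ltW.
Qed.

Lemma char_hullW B B' m : B <= B' -> char_hull B m -> char_hull B' m.
Proof.
move=> BB H; apply: char_hull_lim => D e e0; exists B, m; split=> // [|a b _ _].
  by rewrite (le_trans BB) // lerDl ltW.
by rewrite subrr normr0 ler0c ltW.
Qed.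

Lemma char_hullD B1 B2 m1 m2 : char_hull B1 m1 -> char_hull B2 m2 ->
  char_hull (B1 + B2) (fun a b => m1 a b + m2 a b).
Proof.
move=> H1 H2 D e e0; have e2 : 0 < e / 2 by rewrite divr_gt0.
have [s1 [s11 sB1 sm1]] := H1 D _ e2; have [s2 [s21 sB2 sm2]] := H2 D _ e2.
exists (s1 ++ s2); split; first by rewrite all_cat s11.
  rewrite big_cat /= [X in _ <= X%:C%C](_ : _ = (B1 + e / 2) + (B2 + e / 2)); last by field.
  by rewrite rmorphD lerD.
move=> a b aD bD; rewrite big_cat /= (splitr e) rmorphD opprD addrACA.
by apply: le_trans (ler_normD _ _) _; rewrite lerD ?sm1 ?sm2.
Qed.

Lemma char_hullZ (k : R) B m : char_hull B m ->
  char_hull (`|k| * B) (fun a b => (k%:C)%C * m a b).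
Proof.
(* The [+ 1] keeps the tolerance [e / K] meaningful when [k = 0]. *)
move=> H D e e0; set K := `|k| + 1.
have K0 : 0 < K by rewrite ltr_wpDl.
have nk : `|(k%:C)%C| = ((`|k|)%:C)%C :> R[i].
  by rewrite normc_def /= expr0n /= addr0 sqrtr_sqr.
have ke : `|k| * (e / K) <= e.
  by rewrite mulrCA ler_piMr ?(ltW e0) // ler_pdivrMr // mul1r lerDl.
have [s [s1 sB sm]] := H D _ (divr_gt0 e0 K0).
exists [seq ((k%:C)%C * t.1, t.2) | t <- s]; split.
- by rewrite all_map.
- rewrite big_map /=; under eq_bigr do rewrite normrM.
  rewrite -mulr_sumr nk; apply: (@le_trans _ _ ((`|k|)%:C%C * (B + e / K)%:C%C)).
    by rewrite ler_wpM2l // ler0c.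
  by rewrite -rmorphM /= lecR mulrDr lerD2l.
- move=> a b aD bD; rewrite big_map /=; under eq_bigr do rewrite -mulrA.
  rewrite -mulr_sumr -mulrBr normrM nk.
  apply: (@le_trans _ _ ((`|k|)%:C%C * (e / K)%:C%C)).
    by rewrite ler_wpM2l ?sm // ler0c.
  by rewrite -rmorphM /= lecR.
Qed.

Lemma char_hull0 : char_hull (0 : R) (fun _ _ => 0).
Proof.
apply: (@char_hull_finite [::]) => //.
  by rewrite big_nil ler0c.
by move=> a b; rewrite big_nil.
Qed.

Lemma char_hull_sum (I : Type) (r : seq I) (B : I -> R) (m : I -> nat -> nat -> R[i]) :
  (forall i, char_hull (B i) (m i)) ->
  char_hull (\sum_(i <- r) B i) (fun a b => \sum_(i <- r) m i a b).
Proof.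
move=> H; elim: r => [|i r IH].
  by rewrite big_nil; apply: eq_char_hull char_hull0 => a b; rewrite big_nil.
rewrite big_cons; apply: eq_char_hull (char_hullD (H i) IH) => a b.
by rewrite big_cons.
Qed.

Lemma char_hull_dilate (l u : R[i]) B m : `|l| <= 1 -> `|u| <= 1 -> char_hull B m ->
  char_hull B (fun a b => l ^+ a * u ^+ b * m a b).
Proof.
move=> l1 u1 H D e e0; have [s [s1 sB sm]] := H D _ e0.
exists [seq (t.1, (l * t.2.1, u * t.2.2)) | t <- s]; split.
- rewrite all_map; apply: sub_all s1 => t /= /andP[t1 t2].
  by rewrite !normrM !mulr_ile1.
- by rewrite big_map.
- move=> a b aD bD; rewrite big_map /=.
  have -> : \sum_(j <- s) j.1 * ((l * j.2.1) ^+ a * (u * j.2.2) ^+ b)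
     = l ^+ a * u ^+ b * \sum_(t <- s) t.1 * (t.2.1 ^+ a * t.2.2 ^+ b).
    by rewrite mulr_sumr; apply: eq_bigr => t _; rewrite !exprMn; ring.
  rewrite -mulrBr normrM; apply: le_trans (sm a b aD bD).
  by rewrite ler_piMl // normrM !normrX mulr_ile1 ?exprn_ge0 ?exprn_ile1.
Qed.

(** Each atom [(l, u)] turns the multiplier into the rotation or contraction [z |-> x z] of the
    polydisc, under which the bound [c] persists. Summing over atoms costs the total mass [B]. *)
Lemma mult_norm_le_pullback (n : nat) B m (f g : 'X_{1..n} -> nat) :
  char_hull B m ->
  (forall l u : R[i], `|l| <= 1 -> `|u| <= 1 -> exists x : 'I_n -> R[i],
     (forall i, `|x i| <= 1) /\ (forall al, l ^+ f al * u ^+ g al = \prod_i x i ^+ al i)) ->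
  0 <= B -> mult_norm_le B (fun al => m (f al) (g al)).
Proof.
move=> H fg B0 p c pc z z1; rewrite meval_mscale.
set v := \sum_(al <- _) _; pose S := \sum_(al <- msupp p) `|p@_al|.
have c0 : 0 <= (c%:C)%C by apply: le_trans (pc _ z1).
apply: (@archimedean_lec R _ _ ((c%:C)%C + S) 1).
- by [].
- by rewrite ler0c mulr_ge0 // -ler0c.
- by rewrite addr_ge0 // sumr_ge0.
move=> N N0; have e0 : 0 < (N%:R)^-1 :> R by rewrite invr_gt0 ltr0n.
(* A crude bound for every [f al] and [g al] on the support of [p]. *)
pose D := (\sum_(al <- msupp p) (f al + g al))%N.
have [s [s1 sB sm]] := H D _ e0.
pose q := \sum_(t <- s) t.1 * \sum_(al <- msupp p)
   p@_al * (t.2.1 ^+ f al * t.2.2 ^+ g al) * \prod_i z i ^+ al i.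
have qv : `|v - q| <= (N%:R^-1)%:C%C * S.
  rewrite /q /v; under [X in _ - X]eq_bigr do rewrite mulr_sumr.
  rewrite exchange_big /= -sumrB mulr_sumr big_seq [leRHS]big_seq.
  apply: le_trans (ler_norm_sum _ _ _) _; apply: ler_sum => al alp.
  have -> : p@_al * m (f al) (g al) * \prod_i z i ^+ al i
     - \sum_(j <- s) j.1 * (p@_al * (j.2.1 ^+ f al * j.2.2 ^+ g al) * \prod_i z i ^+ al i)
     = (m (f al) (g al) - \sum_(j <- s) j.1 * (j.2.1 ^+ f al * j.2.2 ^+ g al))
        * (p@_al * \prod_i z i ^+ al i).
    by rewrite mulrBl mulr_suml; congr (_ - _); [ring | apply: eq_bigr => t _; ring].
  rewrite normrM; apply: ler_pM => //.
    by apply: sm; rewrite /D (big_rem al) //=; lia.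
  rewrite normrM ler_piMr // normr_prod prodr_ile1 // => i _.
  by rewrite normr_ge0 normrX exprn_ile1.
have qB : `|q| <= (B + N%:R^-1)%:C%C * (c%:C)%C.
  apply: le_trans (_ : \sum_(t <- s) `|t.1| * (c%:C)%C <= _); last first.
    by rewrite -mulr_suml ler_wpM2r.
  rewrite /q; apply: le_trans (ler_norm_sum _ _ _) _; rewrite big_seq [leRHS]big_seq.
  apply: ler_sum => t ts; have /andP[t1 t2] := allP s1 t ts.
  have [x [x1 xE]] := fg _ _ t1 t2.
  rewrite normrM ler_wpM2l //.
  have -> : \sum_(al <- msupp p) p@_al * (t.2.1 ^+ f al * t.2.2 ^+ g al) * \prod_i z i ^+ al i
     = p.@[fun i => x i * z i].
    rewrite mevalE; apply: eq_bigr => al _; rewrite xE -mulrA -big_split /=.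
    by congr (_ * _); apply: eq_bigr => i _; rewrite exprMn.
  by apply: pc => i; rewrite normrM mulr_ile1.
have Nc : N%:R = (N%:R%:C)%C :> R[i] by rewrite rmorph_nat.
have vle : `|v| <= (N%:R^-1)%:C%C * S + (B + N%:R^-1)%:C%C * (c%:C)%C.
  by rewrite -(subrK q v); apply: le_trans (ler_normD _ _) _; rewrite lerD.
have -> : N%:R * (B * c)%:C%C + (c%:C%C + S)
   = N%:R * ((N%:R^-1)%:C%C * S + (B + N%:R^-1)%:C%C * (c%:C)%C).
  rewrite Nc !rmorphD !rmorphM fmorphV /=; field.
  by rewrite -(rmorph_nat (real_complex R)) fmorph_eq0 pnatr_eq0 -lt0n.
by rewrite ler_wpM2l.
Qed.
End CharHull.

(** * Integrals of moment sequences *)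

(** Induction on [P]; the three estimates go together because each for [P * 'X + c] uses the
    previous ones for [P]. *)
Lemma taylor1_bound (R : realType) (P : {poly R}) :
  {C : R | 0 <= C /\ forall x h : R, 0 <= x <= 1 -> 0 <= h <= 1 ->
     [/\ `|P.[x]| <= C, `|P.[x + h] - P.[x]| <= C * h
       & `|P.[x + h] - P.[x] - h * P^`().[x]| <= C * h ^+ 2]}.
Proof.
elim/poly_ind: P => [|P c [C [C0 H]]].
  exists 0; split=> // x h _ _; rewrite deriv0 !horner0 mulr0 !subr0 normr0 !mul0r.
  by split.
exists (3 * C + `|c|); split; first by rewrite addr_ge0 // mulr_ge0.
move=> x h xI hI; have [H1 H2 H3] := H x h xI hI.
have /andP[x0 x1] := xI; have /andP[h0 h1] := hI.
rewrite derivD derivM derivX derivC mulr1 addr0 !hornerE.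
have nx : `|x| <= 1 by rewrite ger0_norm.
have nh : `|h| = h by rewrite ger0_norm.
have xC y : `|y| <= C -> `|y * x| <= C.
  by move=> yC; rewrite normrM (le_trans _ yC) // ler_piMr.
have c0 : 0 <= `|c| by [].
split.
- by apply: le_trans (ler_normD _ _) _; have := xC _ H1; lra.
- have -> : P.[x + h] * (x + h) + c - (P.[x] * x + c)
     = (P.[x + h] - P.[x]) * x + (P.[x + h] - P.[x]) * h + P.[x] * h by ring.
  have A1 : `|(P.[x + h] - P.[x]) * x| <= C * h.
    by rewrite normrM (le_trans _ H2) // ler_piMr.
  have A2 : `|(P.[x + h] - P.[x]) * h| <= C * h.
    by rewrite normrM (le_trans _ H2) // ler_piMr // nh.
  have A3 : `|P.[x] * h| <= C * h by rewrite normrM nh ler_wpM2r.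
  apply: le_trans (ler_normD _ _) _; apply: le_trans (lerD (ler_normD _ _) (lexx _)) _.
  by have := mulr_ge0 c0 h0; lra.
- rewrite [leRHS](_ : _ = (3 * C + `|c|) * h ^+ 2); last by rewrite expr2 mulrA.
  have -> : P.[x + h] * (x + h) + c - (P.[x] * x + c) - h * (P^`().[x] * x + P.[x])
     = (P.[x + h] - P.[x] - h * P^`().[x]) * x + (P.[x + h] - P.[x]) * h by ring.
  have A1 : `|(P.[x + h] - P.[x] - h * P^`().[x]) * x| <= C * h ^+ 2.
    by rewrite normrM (le_trans _ H3) // ler_piMr.
  have A2 : `|(P.[x + h] - P.[x]) * h| <= C * h ^+ 2.
    by rewrite normrM nh expr2 mulrA ler_wpM2r.
  apply: le_trans (ler_normD _ _) _.
  by have := mulr_ge0 c0 (sqr_ge0 h); have := mulr_ge0 C0 (sqr_ge0 h); lra.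
Qed.

(** [P.[1] - P.[0]] telescopes over [N] cells, each with Taylor error [C / N^2]. The constant is
    given by a sigma type so that one can be picked for every moment at once. *)
Lemma riemann_sum_bound (R : realType) (P : {poly R}) :
  {C : R | 0 <= C /\ forall N : nat, (0 < N)%N ->
    `|N%:R^-1 * \sum_(j < N) P^`().[j%:R / N%:R] - (P.[1] - P.[0])| <= C / N%:R}.
Proof.
have [C [C0 H]] := taylor1_bound P; exists C; split=> // N N0.
have Np : 0 < N%:R :> R by rewrite ltr0n.
have Nn : N%:R != 0 :> R by rewrite gt_eqF.
have tel : P.[1] - P.[0] = \sum_(j < N) (P.[j%:R / N%:R + N%:R^-1] - P.[j%:R / N%:R]).
  rewrite -(big_mkord xpredT (fun j => P.[j%:R / N%:R + N%:R^-1] - P.[j%:R / N%:R])).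
  rewrite (eq_bigr (fun j => P.[j.+1%:R / N%:R] - P.[j%:R / N%:R])) => [|j _].
    by rewrite telescope_sumr // divff // mul0r.
  by rewrite -natr1 mulrDl mul1r.
rewrite tel mulr_sumr -sumrB; apply: le_trans (ler_norm_sum _ _ _) _.
have -> : C / N%:R = \sum_(j < N) C * N%:R^-1 ^+ 2.
  by rewrite sumr_const card_ord -[RHS]mulr_natl; field.
apply: ler_sum => j _; rewrite -normrN opprB.
have I1 : 0 <= (j%:R / N%:R : R) <= 1.
  by apply/andP; split; [rewrite divr_ge0 | rewrite ler_pdivrMr // mul1r ler_nat ltnW].
have I2 : 0 <= (N%:R^-1 : R) <= 1 by rewrite invr_ge0 ler0n /= invf_le1 // ler1n.
by have [_ _] := H _ _ I1 I2.
Qed.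

(** Integrals over [[0, 1]] appear as endpoint differences of antiderivatives: [W] for the mass,
    [P a b] for the moments. Riemann sums are finite sums of measures, and [char_hull_lim] passes to
    the limit. *)
Lemma char_hull_integral (R : realType) (W : {poly R}) (P : nat -> nat -> {poly R}) :
  (forall t : R, 0 <= t <= 1 ->
     char_hull W^`().[t] (fun a b => ((P a b)^`().[t])%:C)%C) ->
  char_hull (W.[1] - W.[0]) (fun a b => ((P a b).[1] - (P a b).[0])%:C)%C.
Proof.
move=> H; apply: char_hull_lim => D e e0.
have [CW [CW0 HW]] := riemann_sum_bound W.
pose E a b := sval (riemann_sum_bound (P a b)).
have E0 a b : 0 <= E a b by have [] := svalP (riemann_sum_bound (P a b)).
have HE a b N : (0 < N)%N ->
    `|N%:R^-1 * \sum_(j < N) (P a b)^`().[j%:R / N%:R] - ((P a b).[1] - (P a b).[0])|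
      <= E a b / N%:R.
  by have [_] := svalP (riemann_sum_bound (P a b)); apply.
(* Dominates the error constants of the mass and of all moments up to [D], so that one [N] serves
   them all. *)
pose S := CW + \sum_(a < D.+1) \sum_(b < D.+1) E a b.
have S0 : 0 <= S by rewrite addr_ge0 // sumr_ge0 // => a _; rewrite sumr_ge0.
pose N := (Num.bound (S / e)).+1.
have Np : 0 < N%:R :> R by rewrite ltr0n.
have SN : S / N%:R <= e.
  rewrite ler_pdivrMr // -ler_pdivrMl // mulrC.
  apply: (le_trans (ltW (archi_boundP _))); first by rewrite divr_ge0 // ltW.
  by rewrite ler_nat.
have CN c : c <= S -> c / N%:R <= e.
  by move=> cS; apply: le_trans SN; rewrite ler_wpM2r // invr_ge0 ltW.
exists (`|N%:R^-1| * \sum_(j < N) W^`().[j%:R / N%:R]).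
exists (fun a b => (N%:R^-1)%:C%C * \sum_(j < N) ((P a b)^`().[j%:R / N%:R])%:C%C); split.
- apply/char_hullZ/char_hull_sum => j; apply: H.
  by apply/andP; split; [rewrite divr_ge0 | rewrite ler_pdivrMr // mul1r ler_nat ltnW].
- rewrite ger0_norm ?invr_ge0 ?ler0n // -lerBlDl.
  apply: le_trans (ler_norm _) _; apply: le_trans (HW _ _) (CN _ _) => //.
  by rewrite /S lerDl sumr_ge0 // => a _; rewrite sumr_ge0.
- move=> a b aD bD; rewrite -rmorph_sum -rmorphM -rmorphB normc_def /= expr0n /= addr0 sqrtr_sqr.
  rewrite lecR -normrN opprB; apply: le_trans (HE _ _ _ _) (CN _ _) => //.
  rewrite /S (bigD1 (Ordinal (aD : (a < D.+1)%N))) //= (bigD1 (Ordinal (bD : (b < D.+1)%N))) //=.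
  rewrite addrCA -addrA lerDl addr_ge0 //; first by rewrite sumr_ge0.
  by rewrite addr_ge0 // sumr_ge0 // => i _; rewrite sumr_ge0.
Qed.

(** The reciprocal of a binomial coefficient, equal to [a + b + 1] times the integral of
    [t^a (1-t)^b] over [[0, 1]]. *)
Definition gam (R : fieldType) (a b : nat) : R := (a`! * b`!)%:R / (a + b)`!%:R.

Lemma beta_antiderivative (R : numFieldType) (a b : nat) :
  {Q : {poly R} | Q^`() = (a + b).+1%:R *: ('X^a * (1 - 'X) ^+ b) & Q.[1] - Q.[0] = gam R a b}.
Proof.
have fn k : k`!%:R != 0 :> R by rewrite pnatr_eq0 -lt0n fact_gt0.
elim: b a => [|b IH] a.
  exists 'X^(a.+1); first by rewrite derivXn expr0 mulr1 addn0 scaler_nat.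
  by rewrite !hornerE expr1n expr0n subr0 /gam addn0 fact0 muln1 divff.
have [Q Q' Q10] := IH a.+1.
have a1 : a.+1%:R != 0 :> R by rewrite pnatr_eq0.
(* Integration by parts: [al] normalizes the wanted term, [be] cancels the one produced by
   differentiating [(1 - 'X) ^+ b.+1]. *)
pose al : R := (a + b).+2%:R / a.+1%:R; pose be : R := b.+1%:R / a.+1%:R.
exists (al *: ('X^(a.+1) * (1 - 'X) ^+ b.+1) + be *: Q); last first.
  rewrite !(hornerD, hornerZ, hornerM, hornerXn) !horner_exp !hornerE subrr !expr0n !expr1n /=.
  rewrite !mulr0 mul0r !add0r -mulrBr Q10 /gam /be addSnnS !factS !natrM.
  by field; rewrite fn nat1r a1.
have E1 : al%:P * a.+1%:R = (a + b).+2%:R :> {poly R}.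
  by rewrite -!polyC_natr -polyCM /al (divfK a1).
have E2 : be%:P * (a + b).+2%:R = al%:P * b.+1%:R :> {poly R}.
  by rewrite -!polyC_natr -!polyCM /al /be; congr (_%:P); field; rewrite nat1r a1.
rewrite derivD !derivZ Q' derivM derivXn deriv_exp derivB derivX derivC /= sub0r.
rewrite addSn addnS -!mul_polyC !polyC_natr.
transitivity ((al%:P * a.+1%:R) * ('X^a * (1 - 'X) ^+ b.+1)
  + (be%:P * (a + b).+2%:R - al%:P * b.+1%:R) * ('X^(a.+1) * (1 - 'X) ^+ b) : {poly R}).
  by rewrite -['X^_ *+ _]mulr_natl -[_ * _ *+ b.+1]mulr_natl /=; ring.
by rewrite E1 E2 subrr mul0r addr0.
Qed.

(** * The Schwarz-Pick measure *)

Local Notation hE := (hornerD, hornerN, hornerM, hornerX, hornerXn, hornerC, hornerZ,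
  hornerMn, horner_exp).

(* Derivative of [x^a y^b] in the direction [(u, v)]. *)
Definition monder (F : pzRingType) (x y u v : F) (a b : nat) : F :=
  u * (x ^+ a.-1 *+ a) * y ^+ b + v * (x ^+ a * (y ^+ b.-1 *+ b)).

(** At [a = 0] the truncated exponent [a.-1] is harmless, being multiplied by zero. *)
Lemma mul_exprn_pred (F : comNzRingType) (x : F) (a : nat) : x * (x ^+ a.-1 *+ a) = a%:R * x ^+ a.
Proof. by case: a => [|a]; rewrite ?mulr0 ?mul0r // mulrnAr -exprS mulr_natl. Qed.

(* With [M := t^a (1-t)^b], [(a+b+1) M = ((t - h) M)' + h' M + D_(h,1-h) M]. *)
Lemma gam_antiderivative (R : numFieldType) (h : {poly R}) (a b : nat) :
  {P : {poly R} | (forall t, P^`().[t]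
       = h^`().[t] * (t ^+ a * (1 - t) ^+ b) + monder t (1 - t) h.[t] (1 - h.[t]) a b)
    & P.[1] - P.[0] = gam R a b - (1 - h.[1]) * 0 ^+ b - h.[0] * 0 ^+ a}.
Proof.
have [Q Q' Q10] := beta_antiderivative R a b.
exists (Q - ('X - h) * ('X^a * (1 - 'X) ^+ b)) => [t|]; last first.
  by rewrite !hE subrr subr0 !expr1n -Q10; ring.
rewrite derivB Q' !derivM derivB derivX derivXn deriv_exp derivB derivX derivC sub0r.
rewrite !hE /monder.
have := mul_exprn_pred t a; have := mul_exprn_pred (1 - t) b.
set A' := t ^+ a.-1 *+ a; set B' := (1 - t) ^+ b.-1 *+ b.
set A := t ^+ a; set B := (1 - t) ^+ b => EB EA.
have -> : (-1) * (1 - t) ^+ b.-1 *+ b = - B' by rewrite /B' mulN1r mulNrn.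
rewrite -natr1 natrD.
have -> : (a%:R + b%:R + 1) * (A * B) = (a%:R * A) * B + A * (b%:R * B) + A * B by ring.
by rewrite -EA -EB; ring.
Qed.

Section Disc.
Variable R : realType.

Lemma norm_real_complex (x : R) : `|(x%:C)%C| = ((`|x|)%:C)%C :> R[i].
Proof. by rewrite normc_def /= expr0n /= addr0 sqrtr_sqr. Qed.

Lemma monder_real_complex (x y u v : R) (a b : nat) :
  monder (x%:C)%C (y%:C)%C (u%:C)%C (v%:C)%C a b = ((monder x y u v a b)%:C)%C.
Proof. by rewrite /monder rmorphD !rmorphM !rmorphMn !rmorphXn. Qed.

(* Moments of the image of the measure [(k0 + k1 conj s + k2 s) ds] on the unit circle under
   the analytic disc [(f, g)]. *)
Lemma char_hull_disc (f g : {poly R[i]}) (k0 k1 k2 : R[i]) (B : R) :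
  (forall s : R[i], `|s| = 1 -> `|f.[s]| <= 1) ->
  (forall s : R[i], `|s| = 1 -> `|g.[s]| <= 1) ->
  (forall (L : nat) (w : R[i]), (1 < L)%N -> L.-primitive_root w ->
     \sum_(j < L) `|k0 + k1 * (w ^+ j)^* + k2 * w ^+ j| <= L%:R * (B%:C)%C) ->
  char_hull B (fun a b => k0 * (f ^+ a * g ^+ b)`_0 + k1 * (f ^+ a * g ^+ b)`_1).
Proof.
move=> f1 g1 kB D e e0.
pose K := (\sum_(a < D.+1) \sum_(b < D.+1) size (f ^+ a * g ^+ b)%R)%N.
have szK a b : (a <= D)%N -> (b <= D)%N -> (size (f ^+ a * g ^+ b)%R <= K)%N.
  move=> aD bD; rewrite /K (bigD1 (Ordinal (aD : (a < D.+1)%N))) //=.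
  by rewrite (bigD1 (Ordinal (bD : (b < D.+1)%N))) //= -addnA leq_addr.
(* The [k2] term pairs with index [L - 1 = K + 1] by wrap-around, beyond the degree of every
   [f ^+ a * g ^+ b] considered, so it affects the mass but no moment. *)
pose L := K.+2; have [w wL] := @prim_root_exists R[i] L isT.
have L0 : (0 < L)%N by [].
have nw j : `|w ^+ j| = 1 by apply: norm_prim_root wL.
have Ln : L%:R != 0 :> R[i] by rewrite pnatr_eq0.
exists [seq (L%:R^-1 * (k0 + k1 * (w ^+ j)^* + k2 * w ^+ j), (f.[w ^+ j], g.[w ^+ j]))
       | j <- iota 0 L]; split.
- by rewrite all_map; apply/allP => j _ /=; rewrite f1 ?g1.
- rewrite big_map -[iota 0 L]/(index_iota 0 L) big_mkord.
  under eq_bigr do rewrite normrM.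
  rewrite -mulr_sumr normfV normr_nat ler_pdivrMl ?ltr0n //.
  apply: le_trans (kB _ _ _ wL) _ => //.
  by rewrite ler_wpM2l ?ler0n // lecR lerDl ltW.
move=> a b aD bD; rewrite big_map -[iota 0 L]/(index_iota 0 L) big_mkord /=.
set F := f ^+ a * g ^+ b.
have szF : (size F <= K)%N by apply: szK.
have FE (j : 'I_L) : L%:R^-1 * (k0 + k1 * (w ^+ j)^* + k2 * w ^+ j) * (f.[w ^+ j] ^+ a * g.[w ^+ j] ^+ b)
   = \sum_(i < L) L%:R^-1 * F`_i * (k0 * ((w ^+ j) ^+ i * ((w ^+ j)^*) ^+ 0)
       + k1 * ((w ^+ j) ^+ i * ((w ^+ j)^*) ^+ 1) + k2 * ((w ^+ j) ^+ i.+1 * ((w ^+ j)^*) ^+ 0)).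
  rewrite -!horner_exp -hornerM -/F (horner_coef_wide _ (leq_trans szF _ : (_ <= L)%N)) ?leqW //.
  rewrite mulr_sumr; apply: eq_bigr => i _; rewrite !expr0 expr1 !mulr1 exprS; ring.
under eq_bigr do rewrite FE.
rewrite exchange_big /=.
have GE (i : 'I_L) : \sum_(j < L) L%:R^-1 * F`_i * (k0 * ((w ^+ j) ^+ i * ((w ^+ j)^*) ^+ 0)
       + k1 * ((w ^+ j) ^+ i * ((w ^+ j)^*) ^+ 1) + k2 * ((w ^+ j) ^+ i.+1 * ((w ^+ j)^*) ^+ 0))
   = F`_i * (k0 * (i == 0%N :> nat)%:R + k1 * (i == 1%N :> nat)%:R).
  rewrite -mulr_sumr big_split big_split -!mulr_sumr !sum_prim_root //=.
  have iL := ltn_ord i.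
  have -> : (i == 0 %[mod L])%N = (i == 0%N :> nat) by rewrite modn_small ?mod0n.
  have -> : (i == 1 %[mod L])%N = (i == 1%N :> nat) by rewrite !modn_small.
  have [iK|iK] := ltnP i K; last by rewrite (nth_default 0 (leq_trans szF iK)) !mulr0 !mul0r.
  have -> : (i.+1 == 0 %[mod L])%N = false by rewrite mod0n modn_small // ltnS leqW.
  rewrite /= mulr0n !mulr0 addr0; move: Ln; set l := L%:R => Ln.
  by field.
under eq_bigr do rewrite GE.
rewrite !big_ord_recl /= big1 => [|i _]; last by rewrite !mulr0 addr0 mulr0.
rewrite [X in `|X|](_ : _ = 0) ?normr0 ?ler0c ?(ltW e0) //.
by rewrite /bump /=; ring.
Qed.

Lemma coef_exp_exp (F : comNzRingType) (f g : {poly F}) (a b : nat) :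
  (f ^+ a * g ^+ b)`_0 = f`_0 ^+ a * g`_0 ^+ b /\
  (f ^+ a * g ^+ b)`_1 = monder f`_0 g`_0 f`_1 g`_1 a b.
Proof.
have d1 (p : {poly F}) : p`_1 = p^`().[0] by rewrite horner_coef0 coef_deriv mulr1n.
split; first by rewrite -!horner_coef0 !hE.
rewrite !d1 -!horner_coef0 derivM !deriv_exp !hE /monder.
rewrite -!mulrnAr; ring.
Qed.

(** Cauchy's formula for the first Taylor coefficient along the affine disc
    [s |-> (x + u s, y + v s)], which stays in the bidisc; its weight [conj s] is unimodular. *)
Lemma char_hull_cauchy (x y u v : R) :
  `|x| + `|u| <= 1 -> `|y| + `|v| <= 1 ->
  char_hull 1 (fun a b => ((monder x y u v a b)%:C)%C).
Proof.
move=> xu yv.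
pose lin (x u : R) : {poly R[i]} := (x%:C)%C%:P + (u%:C)%C *: 'X.
have lin1 x' u' s : `|x'| + `|u'| <= 1 -> `|s| = 1 -> `|(lin x' u').[s]| <= 1.
  move=> xu1 s1; rewrite !hE; apply: le_trans (ler_normD _ _) _.
  by rewrite normrM s1 mulr1 !norm_real_complex -rmorphD lecR.
have c0 x' u' : (lin x' u')`_0 = (x'%:C)%C.
  by rewrite coefD coefC coefZ coefX mulr0 addr0.
have c1 x' u' : (lin x' u')`_1 = (u'%:C)%C.
  by rewrite coefD coefC coefZ coefX mulr1 add0r.
have H := @char_hull_disc (lin x u) (lin y v) 0 1 0 1.
apply: eq_char_hull (H _ _ _) => [a b|s s1|s s1|L w L1 wL].
- have [_ ->] := coef_exp_exp (lin x u) (lin y v) a b.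
  by rewrite !c0 !c1 mul0r add0r mul1r monder_real_complex.
- exact: lin1.
- exact: lin1.
rewrite mulr1 (eq_bigr (fun=> 1)) => [|j _].
  by rewrite sumr_const card_ord.
rewrite add0r mul1r mul0r addr0 norm_conjC (norm_prim_root _ _ wL) //.
exact: ltnW.
Qed.

(* [f] is a Taylor polynomial of [(x + m s) / (1 + x m s)], where [m = u / (1 - x^2)]. *)
Lemma moebius_truncation (q x u : R) (N : nat) :
  q < 1 -> 0 <= x <= q -> 0 <= u <= 1 - x ^+ 2 ->
  exists f : {poly R[i]}, [/\ f`_0 = (x%:C)%C, f`_1 = (u%:C)%C &
    forall s : R[i], `|s| = 1 -> `|f.[s]| <= ((1 + 2 * q ^+ N.+1)%:C)%C].
Proof.
move=> q1 /andP[x0 xq] /andP[u0 ux].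
have x1 : x < 1 by apply: le_lt_trans xq q1.
have x2 : 0 < 1 - x ^+ 2 by rewrite subr_gt0 expr_lt1.
pose m := u / (1 - x ^+ 2).
have m0 : 0 <= m by rewrite divr_ge0 // ltW.
have m1 : m <= 1 by rewrite ler_pdivrMr // mul1r.
have mu : m * (1 - x ^+ 2) = u by rewrite divfK // gt_eqF.
pose c := x * m.
have c0 : 0 <= c by rewrite mulr_ge0.
have cx : c <= x by rewrite ler_piMr.
have c1 : c < 1 by apply: le_lt_trans cx x1.
pose S : {poly R[i]} := \sum_(k < N.+1) (- (c%:C)%C *: 'X) ^+ k.
exists ((x%:C)%C%:P + (u%:C)%C *: ('X * S)); split.
- by rewrite coefD coefC coefZ coefXM mulr0 addr0.
- rewrite coefD coefC coefZ coefXM /= add0r -horner_coef0 /S horner_sum big_ord_recl.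
  rewrite expr0 hornerC big1 ?addr0 ?mulr1 // => k _.
  by rewrite !hE mulr0 expr0n.
move=> s s1; rewrite !hE; set Ss := S.[s].
have SsE : (1 + (c%:C)%C * s) * Ss = 1 - (- (c%:C)%C * s) ^+ N.+1.
  have -> : Ss = \sum_(k < N.+1) (- (c%:C)%C * s) ^+ k.
    by rewrite /Ss horner_sum; apply: eq_bigr => k _; rewrite !hE.
  have := subrX1 (- (c%:C)%C * s) N.+1; set Z := \sum_(_ < _) _ => E.
  by rewrite -opprB E; ring.
set C := (c%:C)%C in SsE; set X := (x%:C)%C; set U := (u%:C)%C; pose M : R[i] := (m%:C)%C.
have CE : C = X * M by rewrite /C /c rmorphM.
have UE : U = M * (1 - X ^+ 2) by rewrite /U -mu rmorphM rmorphB rmorph1 rmorphXn.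
have GE : (1 + C * s) * (X + U * (s * Ss)) = (X + M * s) - U * s * (- C * s) ^+ N.+1.
  transitivity ((1 + C * s) * X + U * s * ((1 + C * s) * Ss)); first by ring.
  by rewrite SsE UE CE; ring.
have conjR (r : R) : ((r%:C)%C : R[i])^* = (r%:C)%C.
  by apply: conj_Creal; apply/complex_realP; exists r.
have ss : s * s^* = 1 by rewrite -normCK s1 expr1n.
have le1 : `|X + M * s| <= `|1 + C * s|.
  rewrite -(@ler_pXn2r _ 2) ?nnegrE // !normCK !rmorphD !rmorphM rmorph1 /=.
  rewrite !conjR -subr_ge0.
  have -> : (1 + C * s) * (1 + C * s^*) - (X + M * s) * (X + M * s^*)
     = (1 - X ^+ 2) * (1 - M ^+ 2) + (C ^+ 2 - M ^+ 2) * (s * s^* - 1).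
    by rewrite CE; ring.
  rewrite ss subrr mulr0 addr0 /X /M -!rmorphXn -(rmorph1 (real_complex R)) -!rmorphB -rmorphM ler0c.
  by rewrite mulr_ge0 ?(ltW x2) // subr_ge0 expr_le1.
have den : ((1 - c)%:C)%C <= `|1 + C * s|.
  have := lerB_normD 1 (C * s); rewrite normr1 normrM s1 mulr1 norm_real_complex ger0_norm //.
  by rewrite rmorphB rmorph1.
have den0 : 0 < `|1 + C * s| by apply: lt_le_trans den; rewrite ltcR subr_gt0.
rewrite -(ler_pM2l den0) -normrM GE; apply: le_trans (ler_normB _ _) _.
rewrite rmorphD rmorph1 mulrDr mulr1 /=; apply: lerD => //.
rewrite !normrM normrX normrM normrN s1 !mulr1 !norm_real_complex (ger0_norm u0) (ger0_norm c0).
(* The tail is [u c^(N+1)], with [u <= 1 - x^2 <= 2 (1 - x) <= 2 (1 - c)] and [c <= x <= q]. *)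
rewrite -rmorphXn -rmorphM; apply: (@le_trans _ _ ((1 - c)%:C%C * (2 * q ^+ N.+1)%:C%C)).
  rewrite -rmorphM lecR mulrA; apply: ler_pM => //; first by rewrite exprn_ge0.
    apply: le_trans ux _; nra.
  by rewrite lerXn2r ?nnegrE ?(le_trans cx) // (le_trans x0).
rewrite ler_wpM2r // ler0c mulr_ge0 // exprn_ge0 // (le_trans x0) //.
Qed.

(** Bernoulli's inequality for [q^-1 = 1 + d]; [q = 0] is treated apart. *)
Lemma expr_small (q e : R) : 0 <= q < 1 -> 0 < e -> exists N : nat, q ^+ N.+1 <= e.
Proof.
move=> /andP[q0 q1] e0; move: q0; rewrite le_eqVlt => /orP[/eqP <-|q0].
  by exists 0%N; rewrite expr1 ltW.
pose d := q^-1 - 1; have d0 : 0 < d by rewrite subr_gt0 invf_gt1.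
have bern n : 1 + n%:R * d <= q^-1 ^+ n.
  elim: n => [|n IH]; first by rewrite mul0r addr0 expr0.
  rewrite exprS; have -> : q^-1 = 1 + d by rewrite /d; ring.
  move: IH; have -> : q^-1 = 1 + d by rewrite /d; ring.
  rewrite -natr1 mulrDl mul1r; have : 0 <= n%:R * d by rewrite mulr_ge0 // ltW.
  set y := n%:R * d; set z := (1 + d) ^+ n => y0 H.
  have : 0 <= d * (z - (1 + y)) by apply: (mulr_ge0 (ltW d0)); rewrite subr_ge0.
  by have := mulr_ge0 (ltW d0) y0; lra.
exists (Num.bound (e^-1 / d)); set n := Num.bound _.
rewrite -[q ^+ _]invrK -exprVn invf_ple ?posrE //; last first.
  by rewrite exprn_gt0 // invr_gt0.
apply: le_trans (bern _).
have := archi_boundP (_ : 0 <= e^-1 / d); rewrite -/n => H.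
have : e^-1 / d < n%:R by apply: H; rewrite divr_ge0 ?invr_ge0 // ltW.
rewrite ltr_pdivrMr // => H2; apply: (le_trans (ltW H2)).
by rewrite -natr1 mulrDl; have := ltW d0; lra.
Qed.

(* The functional [f |-> f(P) + D_w f(P) / 2] is the average of [f o phi] with weight
   [1 + Re s], for a disc [phi] with [phi 0 = P] and [phi' 0 = w]. *)
Lemma char_hull_schwarz_pick (q x y u v : R) :
  q < 1 -> 0 <= x <= q -> 0 <= y <= q -> 0 <= u <= 1 - x ^+ 2 -> 0 <= v <= 1 - y ^+ 2 ->
  char_hull 1 (fun a b => ((x ^+ a * y ^+ b + 2^-1 * monder x y u v a b)%:C)%C).
Proof.
move=> q1 xI yI uI vI; apply: char_hull_lim => D e e0.
have q0 : 0 <= q by case/andP: xI => x0 /(le_trans x0).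
pose r a b := x ^+ a * y ^+ b + 2^-1 * monder x y u v a b.
pose S := \sum_(a < D.+1) \sum_(b < D.+1) `|r a b|.
have S0 : 0 <= S by apply: sumr_ge0 => a _; apply: sumr_ge0.
have rS a b : (a <= D)%N -> (b <= D)%N -> `|r a b| <= S.
  move=> aD bD; rewrite /S (bigD1 (Ordinal (aD : (a < D.+1)%N))) //=.
  rewrite (bigD1 (Ordinal (bD : (b < D.+1)%N))) //= -addrA lerDl addr_ge0 ?sumr_ge0 //.
  by move=> i _; apply: sumr_ge0.
pose K := 1 + (D + D)%:R * S.
have K0 : 0 < K by rewrite ltr_wpDr // mulr_ge0.
have [N qN] := @expr_small q (e / K / 2) (introT andP (conj q0 q1)) (divr_gt0 (divr_gt0 e0 K0) (ltr0n _ 2)).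
pose ep := 2 * q ^+ N.+1.
have ep0 : 0 <= ep by rewrite mulr_ge0 // exprn_ge0.
have epK : ep * K <= e by rewrite -ler_pdivlMr // /ep mulrC -ler_pdivlMr.
have [f [f0 f1 fb]] := moebius_truncation N q1 xI uI.
have [g [g0 g1 gb]] := moebius_truncation N q1 yI vI.
(* Shrinks the truncated discs back into the unit disc. The moments change by the factor
   [k ^+ (a + b)], at distance at most [(a + b) * ep] from 1. *)
pose k := (1 + ep)^-1.
have ep1 : 0 < 1 + ep by rewrite ltr_wpDr.
have k0 : 0 <= k by rewrite invr_ge0 ltW.
have k1 : k <= 1 by rewrite invf_le1 // lerDl.
have scaled (h : {poly R[i]}) :
    (forall s : R[i], `|s| = 1 -> `|h.[s]| <= ((1 + ep)%:C)%C) ->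
    forall s : R[i], `|s| = 1 -> `|((k%:C)%C *: h).[s]| <= 1.
  move=> hb s s1; rewrite hornerZ normrM norm_real_complex (ger0_norm k0).
  apply: (@le_trans _ _ ((k%:C)%C * ((1 + ep)%:C)%C)).
    by apply: ler_wpM2l; rewrite ?ler0c ?hb.
  by rewrite -rmorphM mulVf ?gt_eqF // rmorph1.
exists 1, (fun a b => ((k ^+ (a + b) * r a b)%:C)%C); split.
- have H := @char_hull_disc ((k%:C)%C *: f) ((k%:C)%C *: g) 1 2^-1 2^-1 1.
  apply: eq_char_hull (H (scaled _ fb) (scaled _ gb) _) => [a b|L w L1 wL].
    rewrite !exprZn -!scalerAl -!scalerAr !coefZ.
    have [-> ->] := coef_exp_exp f g a b.
    rewrite f0 f1 g0 g1 monder_real_complex [in RHS]rmorphM [in RHS]rmorphXn /=.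
    have half : ((2^-1)%:C)%C = 2^-1 :> R[i] by rewrite fmorphV rmorph_nat.
    have -> : ((r a b)%:C)%C = ((x%:C)%C ^+ a * (y%:C)%C ^+ b
        + 2^-1 * ((monder x y u v a b)%:C)%C).
      by rewrite -half -!rmorphXn -!rmorphM -rmorphD.
    by rewrite exprD; ring.
  have L0 : (0 < L)%N by apply: ltnW.
  rewrite mulr1.
  (* The weight is [|1 + s|^2 / 2], hence nonnegative, and its absolute value averages to its
     constant term 1. *)
  have E (j : 'I_L) : `|1 + 2^-1 * (w ^+ j)^* + 2^-1 * w ^+ j|
      = (w ^+ j) ^+ 0 * ((w ^+ j)^*) ^+ 0 + 2^-1 * ((w ^+ j) ^+ 0 * ((w ^+ j)^*) ^+ 1)
        + 2^-1 * ((w ^+ j) ^+ 1 * ((w ^+ j)^*) ^+ 0).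
    rewrite !expr0 !expr1 !mulr1 !mul1r ger0_norm //.
    have ww : w ^+ j * (w ^+ j)^* = 1.
      by rewrite -normCK (norm_prim_root _ L0 wL) expr1n.
    have -> : 1 + 2^-1 * (w ^+ j)^* + 2^-1 * w ^+ j
       = 2^-1 * `|1 + w ^+ j| ^+ 2 + 2^-1 * (1 - w ^+ j * (w ^+ j)^*).
      by rewrite normCK rmorphD rmorph1 /=; field.
    by rewrite ww subrr mulr0 addr0 mulr_ge0 ?invr_ge0 // exprn_ge0.
  under eq_bigr do rewrite E.
  pose S' e f := \sum_(j < L) (w ^+ j) ^+ e * ((w ^+ j)^*) ^+ f.
  have -> : \sum_(j < L) ((w ^+ j) ^+ 0 * ((w ^+ j)^*) ^+ 0
        + 2^-1 * ((w ^+ j) ^+ 0 * ((w ^+ j)^*) ^+ 1)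
        + 2^-1 * ((w ^+ j) ^+ 1 * ((w ^+ j)^*) ^+ 0))
      = S' 0 0 + 2^-1 * S' 0 1 + 2^-1 * S' 1 0.
    by rewrite /S' !mulr_sumr -!big_split.
  rewrite /S' !sum_prim_root // !modn_small // eqxx.
  by rewrite -[0 == 1]/false -[1 == 0]/false mulr0n !mulr0 !addr0 mulr1.
- by rewrite lerDl ltW.
- move=> a b aD bD; rewrite -rmorphB norm_real_complex lecR -/(r a b).
  have bern n : 1 - k ^+ n <= n%:R * ep.
    elim: n => [|n IH]; first by rewrite expr0 subrr mul0r.
    have kn1 : k ^+ n <= 1 by rewrite exprn_ile1.
    have kn0 : 0 <= k ^+ n by rewrite exprn_ge0.
    have : k * (1 + ep) = 1 by rewrite mulVf // gt_eqF.
    by rewrite exprSr -natr1 mulrDl mul1r => kE; nra.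
  have -> : r a b - k ^+ (a + b) * r a b = (1 - k ^+ (a + b)) * r a b by ring.
  rewrite normrM ger0_norm ?subr_ge0 ?exprn_ile1 //; apply: le_trans epK.
  apply: (@le_trans _ _ ((D + D)%:R * ep * S)).
    apply: ler_pM => //; first by rewrite subr_ge0 exprn_ile1.
      by apply: le_trans (bern _) _; rewrite ler_wpM2r // ler_nat leq_add.
    exact: rS.
  by rewrite /K; have := mulr_ge0 ep0 (ler0n R 1); lra.
Qed.
End Disc.

(** * The multiplier [a! b! / (a+b)!] *)

Lemma monderZ (F : comNzRingType) (k x y u v : F) (a b : nat) :
  monder x y (k * u) (k * v) a b = k * monder x y u v a b.
Proof. by rewrite /monder; ring. Qed.

Lemma monder_dilate (F : comNzRingType) (X Y x y u v : F) (a b : nat) :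
  monder (X * x) (Y * y) (X * u) (Y * v) a b = X ^+ a * Y ^+ b * monder x y u v a b.
Proof.
have E (z t : F) k : z * ((z * t) ^+ k.-1 *+ k) = z ^+ k * (t ^+ k.-1 *+ k).
  by case: k => [|k] /=; rewrite ?mulr0n ?mulr0 // exprMn !mulrnAr mulrA exprS.
rewrite /monder.
have -> : X * u * ((X * x) ^+ a.-1 *+ a) = u * (X * ((X * x) ^+ a.-1 *+ a)) by ring.
have -> : Y * v * ((X * x) ^+ a * ((Y * y) ^+ b.-1 *+ b))
   = v * ((X * x) ^+ a * (Y * ((Y * y) ^+ b.-1 *+ b))) by ring.
by rewrite !E !exprMn; ring.
Qed.

Section GammaHull.
Variable R : realType.

Lemma gam_char_hull (X Y : R) (h W : {poly R}) :
  (forall t, 0 <= t <= 1 -> char_hull W^`().[t] (fun a b =>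
     ((X ^+ a * Y ^+ b * (h^`().[t] * (t ^+ a * (1 - t) ^+ b)
        + monder t (1 - t) h.[t] (1 - h.[t]) a b))%:C)%C)) ->
  char_hull (W.[1] - W.[0]) (fun a b =>
     ((X ^+ a * Y ^+ b * (gam R a b - (1 - h.[1]) * 0 ^+ b - h.[0] * 0 ^+ a))%:C)%C).
Proof.
move=> H.
pose P a b : {poly R} := (X ^+ a * Y ^+ b) *: s2val (gam_antiderivative h a b).
apply: (@eq_char_hull R _ (fun a b => (((P a b).[1] - (P a b).[0])%:C)%C)) => [a b|].
  by rewrite /P !hornerZ -mulrBr; case: gam_antiderivative => Q /= _ ->.
apply: char_hull_integral => t tI; apply: eq_char_hull (H t tI) => a b.
by rewrite /P derivZ hornerZ; case: gam_antiderivative => Q /= ->.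
Qed.

(** With [h = 1 - t] the integrand is minus a character plus a derivative in direction [(1 - t, t)],
    to which [char_hull_cauchy] applies: mass [1 + 1]. The boundary terms [0^b] and [0^a] are the
    characters at [(1, 0)] and [(0, 1)], each of mass 1. *)
Lemma gam_char_hull4 : char_hull (4 : R) (fun a b => ((gam R a b)%:C)%C).
Proof.
have H : char_hull ((2%:P * 'X : {poly R}).[1] - (2%:P * 'X : {poly R}).[0]) (fun a b =>
   ((1 ^+ a * 1 ^+ b * (gam R a b - (1 - (1 - 'X : {poly R}).[1]) * 0 ^+ b
      - (1 - 'X : {poly R}).[0] * 0 ^+ a))%:C)%C).
  apply: gam_char_hull => t /andP[t0 t1].
  have nt : `|t| = t by rewrite ger0_norm.
  have nt' : `|1 - t| = 1 - t by rewrite ger0_norm // subr_ge0.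
  rewrite derivM derivB derivX !derivC mul0r add0r mulr1 sub0r !hE.
  have A := char_hullZ (-1) (@char_hull_char R (t%:C)%C ((1 - t)%:C)%C _ _).
  have B := @char_hull_cauchy R t (1 - t) (1 - t) t _ _.
  rewrite -[X in char_hull X](_ : `|-1| * 1 + 1 = 2); last by rewrite normrN1; ring.
  apply: eq_char_hull (char_hullD (A _ _) (B _ _)) => [a b||||].
  - by rewrite !expr1n !mul1r subKr -!rmorphXn -!rmorphM -rmorphD.
  - by rewrite norm_real_complex lecR nt.
  - by rewrite norm_real_complex -(rmorph1 (real_complex R)) lecR nt' gerBl.
  - by rewrite nt nt' addrC subrK.
  - by rewrite nt nt' subrK.
have A := @char_hull_char R 1 0 _ _; have B := @char_hull_char R 0 1 _ _.
move: H; rewrite !hE mulr0 subr0 mulr1 => H.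
rewrite -[X in char_hull X](_ : 2 + (1 + 1) = 4); last by ring.
apply: eq_char_hull (char_hullD H (char_hullD (A _ _) (B _ _))) => [a b||||];
  rewrite ?normr1 ?normr0 //.
have z k : (0 : R[i]) ^+ k = ((0 ^+ k)%:C)%C by rewrite rmorphXn rmorph0.
by rewrite !expr1n !mul1r mulr1 !z -!rmorphD; congr (_%:C)%C; ring.
Qed.

(** The integrand is [h'] times a Schwarz-Pick functional at [(X t, Y (1-t))] in direction
    [(2 X h / h', 2 Y (1-h) / h')]; the two differential inequalities say that this direction is
    admissible. Its mass is [h'], so [W = h] and the total is [h 1 - h 0 = 1]. *)
Lemma gam_char_hull1 (X Y : R) (h : {poly R}) :
  0 <= X < 1 -> 0 <= Y < 1 -> h.[0] = 0 -> h.[1] = 1 ->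
  (forall t, 0 <= t <= 1 -> [/\ 0 < h^`().[t], 0 <= h.[t] <= 1,
      2 * X * h.[t] <= h^`().[t] * (1 - X ^+ 2 * t ^+ 2)
    & 2 * Y * (1 - h.[t]) <= h^`().[t] * (1 - Y ^+ 2 * (1 - t) ^+ 2)]) ->
  char_hull 1 (fun a b => ((X ^+ a * Y ^+ b * gam R a b)%:C)%C).
Proof.
move=> /andP[X0 X1] /andP[Y0 Y1] h0 h1 Hh.
have := @gam_char_hull X Y h h; rewrite h0 h1 subr0 => H.
apply: eq_char_hull (H _) => [a b|t tI]; first by rewrite subrr !mul0r !subr0.
have [d0 /andP[ht0 ht1] HX HY] := Hh t tI; have /andP[t0 t1] := tI.
set d := h^`().[t] in d0 HX HY *; set g := h.[t] in ht0 ht1 HX HY *.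
have SP := @char_hull_schwarz_pick R (Num.max X Y) (X * t) (Y * (1 - t))
  (2 * X * g / d) (2 * Y * (1 - g) / d) _ _ _ _ _.
apply: eq_char_hull (@char_hullW _ (`|d| * 1) _ _ _ (char_hullZ d (SP _ _ _ _ _))) => [a b||||||].
- rewrite -rmorphM /=; congr (_%:C)%C.
  have -> : 2 * X * g / d = (2 / d) * (X * g) by field; rewrite gt_eqF.
  have -> : 2 * Y * (1 - g) / d = (2 / d) * (Y * (1 - g)) by field; rewrite gt_eqF.
  rewrite monderZ monder_dilate !exprMn.
  by field; rewrite gt_eqF.
- by rewrite mulr1 gtr0_norm.
- by rewrite gt_max X1.
- by rewrite mulr_ge0 //= le_max ler_piMr.
- by rewrite mulr_ge0 ?subr_ge0 //= le_max orbC ler_piMr ?gerBl.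
- rewrite divr_ge0 ?mulr_ge0 ?(ltW d0) //= ler_pdivrMr //.
  by rewrite exprMn [leRHS]mulrC.
- rewrite divr_ge0 ?mulr_ge0 ?subr_ge0 ?(ltW d0) //= ler_pdivrMr //.
  by rewrite exprMn [leRHS]mulrC.
Qed.

(** * Explicit polynomials [h] and their certificates *)

Lemma bernstein_ge0 (lo hi t : R) (k l : nat) : lo <= t -> t <= hi ->
  0 <= (t - lo) ^+ k * (hi - t) ^+ l.
Proof. by move=> lt th; rewrite mulr_ge0 // exprn_ge0 // subr_ge0. Qed.

(* Certifies a polynomial inequality on [[lo, hi]] by nonnegative Bernstein coefficients. *)
Ltac bernstein4 lo hi :=
  have := bernstein_ge0 0 4 lo hi;
  have := bernstein_ge0 1 3 lo hi;
  have := bernstein_ge0 2 2 lo hi;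
  have := bernstein_ge0 3 1 lo hi;
  have := bernstein_ge0 4 0 lo hi;
  lra.

Ltac bernstein6 lo hi :=
  have := bernstein_ge0 0 6 lo hi;
  have := bernstein_ge0 1 5 lo hi;
  have := bernstein_ge0 2 4 lo hi;
  have := bernstein_ge0 3 3 lo hi;
  have := bernstein_ge0 4 2 lo hi;
  have := bernstein_ge0 5 1 lo hi;
  have := bernstein_ge0 6 0 lo hi;
  lra.

(* Here and below, [h] is a rounded numerical solution of the linear program given by the
   differential inequalities of [gam_char_hull1]; they hold with margin 0.002. *)
Lemma gam_char_hull_symmetric :
  char_hull (1 : R) (fun a b => (((50%:R / 91%:R) ^+ a * (50%:R / 91%:R) ^+ b * gam R a b)%:C)%C).
Proof.
(* Equal dilations allow [h (1 - t) = 1 - h t]. *)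
pose h : {poly R} :=
  (158%:R / 100%:R) *: 'X^1 + (- (174%:R / 100%:R)) *: 'X^2
  + (116%:R / 100%:R) *: 'X^3.
have hE' t : h.[t] =
  158%:R / 100%:R * t ^+ 1 + (- (174%:R / 100%:R)) * t ^+ 2 + 116%:R / 100%:R * t ^+ 3.
  by rewrite /h !hE.
have dE t : h^`().[t] =
  158%:R / 100%:R * t ^+ 0 + (- (348%:R / 100%:R)) * t ^+ 1 + 348%:R / 100%:R * t ^+ 2.
  by rewrite /h !derivD !derivZ !derivXn !hE /=; field.
apply: (@gam_char_hull1 _ _ h); rewrite ?hE'; try lra.
move=> t /andP[t0 t1]; rewrite hE' dE; split.
- bernstein4 t0 t1.
- by apply/andP; split; bernstein4 t0 t1.
(* The degree is 4, from [h'] of degree 2 times [1 - X^2 t^2]. Bernstein coefficients come closer to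
   the values of the polynomial on shorter intervals. *)
- case: (lerP t (1%:R / 2%:R)) => [hi1|/ltW lo1]; first by bernstein4 t0 hi1.
  case: (lerP t (3%:R / 4%:R)) => [hi2|/ltW lo2]; first by bernstein4 lo1 hi2.
  by bernstein4 lo2 t1.
- case: (lerP t (1%:R / 4%:R)) => [hi1|/ltW lo1]; first by bernstein4 t0 hi1.
  case: (lerP t (1%:R / 2%:R)) => [hi2|/ltW lo2]; first by bernstein4 lo1 hi2.
  by bernstein4 lo2 t1.
Qed.

Lemma gam_char_hull_asymmetric :
  char_hull (1 : R) (fun a b => (((7%:R / 10%:R) ^+ a * (5%:R / 13%:R) ^+ b * gam R a b)%:C)%C).
Proof.
(* The dilations satisfy [(50/91) (7/10) = 5/13], as required in three variables. Here [h'] has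
   degree 4, whence certificates of degree 6. *)
pose h : {poly R} :=
  (907%:R / 1000%:R) *: 'X^1 + (- (513%:R / 1000%:R)) *: 'X^2
  + (104%:R / 1000%:R) *: 'X^3 + (- (47%:R / 1000%:R)) *: 'X^4
  + (549%:R / 1000%:R) *: 'X^5.
have hE' t : h.[t] =
  907%:R / 1000%:R * t ^+ 1 + (- (513%:R / 1000%:R)) * t ^+ 2
  + 104%:R / 1000%:R * t ^+ 3 + (- (47%:R / 1000%:R)) * t ^+ 4
  + 549%:R / 1000%:R * t ^+ 5.
  by rewrite /h !hE.
have dE t : h^`().[t] =
  907%:R / 1000%:R * t ^+ 0 + (- (1026%:R / 1000%:R)) * t ^+ 1
  + 312%:R / 1000%:R * t ^+ 2 + (- (188%:R / 1000%:R)) * t ^+ 3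
  + 2745%:R / 1000%:R * t ^+ 4.
  by rewrite /h !derivD !derivZ !derivXn !hE /=; field.
apply: (@gam_char_hull1 _ _ h); rewrite ?hE'; try lra.
move=> t /andP[t0 t1]; rewrite hE' dE; split.
- bernstein6 t0 t1.
- by apply/andP; split; bernstein6 t0 t1.
- case: (lerP t (1%:R / 2%:R)) => [hi1|/ltW lo1]; first by bernstein6 t0 hi1.
  case: (lerP t (5%:R / 8%:R)) => [hi2|/ltW lo2]; first by bernstein6 lo1 hi2.
  case: (lerP t (3%:R / 4%:R)) => [hi3|/ltW lo3]; first by bernstein6 lo2 hi3.
  by bernstein6 lo3 t1.
- case: (lerP t (1%:R / 4%:R)) => [hi1|/ltW lo1]; first by bernstein6 t0 hi1.
  case: (lerP t (1%:R / 2%:R)) => [hi2|/ltW lo2]; first by bernstein6 lo1 hi2.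
  by bernstein6 lo2 t1.
Qed.

End GammaHull.

(** * Counting orderings *)

(** The multinomial formula, by splitting off the first letter [i]: it contributes [f i * k!], and
    these add up to [(k+1)!]. *)
Lemma count_words (n k : nat) (f : 'I_n -> nat) : (\sum_j f j = k)%N ->
  ((\sum_(w : k.-tuple 'I_n) [forall j, count_mem j w == f j]) * \prod_j (f j)`! = k`!)%N.
Proof.
elim: k f => [|k IH] f fk.
  have f0 j : f j = 0%N by apply/eqP; move/eqP: fk; rewrite sum_nat_eq0 => /forallP/(_ j).
  rewrite big_tuple_nil big1 => [|j _]; last by rewrite f0.
  by rewrite muln1; case: forallP => // -[] j; rewrite f0.
rewrite big_tuple_cons big_distrl /= factS -fk big_distrl /=; apply: eq_bigr => i _.
have [fi|fi] := posnP (f i).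
  rewrite fi mul0n big1 ?mul0n // => w _; case: forallP => // /(_ i) /=.
  by rewrite eqxx fi.
pose g j := (f j - (i == j))%N.
have fg j : (f j = (i == j) + g j)%N.
  by rewrite /g subnKC //; case: eqP => // <-.
have gk : (\sum_j g j = k)%N.
  have : (\sum_j f j = 1 + \sum_j g j)%N.
    under eq_bigr do rewrite fg.
    rewrite big_split /= (bigD1 i) //= eqxx big1 // => j; rewrite eq_sym.
    by move=> /negbTE ->.
  by rewrite fk => -[].
have -> : (\prod_j (f j)`! = f i * \prod_j (g j)`!)%N.
  rewrite (bigD1 i) //= [in RHS](bigD1 i) //= mulnA; congr (_ * _)%N.
    by rewrite /g eqxx; case: (f i) fi => // m _; rewrite factS subn1.
  by apply: eq_bigr => j ji; rewrite fg eq_sym (negbTE ji).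
rewrite mulnCA -(IH g gk); congr (_ * (_ * _))%N; apply: eq_bigr => w _.
congr nat_of_bool; apply: eq_forallb => j /=.
by rewrite fg eqn_add2l.
Qed.

Lemma card_orderings (n : nat) (al : 'X_{1..n}) :
  (#|orderings al| * \prod_j (al j)`! = (mdeg al)`!)%N.
Proof.
rewrite -(@count_words n (mdeg al) al) ?mdegE //; congr (_ * _)%N.
rewrite cardE -sum1_size big_enum /= big_mkcond /=; apply: eq_bigr => w _.
by rewrite inE; case: ifP.
Qed.

(** Indexed by natural numbers, with exponent 0 past [n], so that products over the variables can be
    handled by induction. *)
Definition mpsum (n : nat) (al : 'X_{1..n}) (k : nat) : nat :=
  (\sum_(0 <= i < k) nth 0 al i)%N.

Lemma mpsum0 (n : nat) (al : 'X_{1..n}) : mpsum al 0 = 0%N.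
Proof. by rewrite /mpsum big_geq. Qed.

Lemma mpsumS (n : nat) (al : 'X_{1..n}) (k : nat) :
  mpsum al k.+1 = (mpsum al k + nth 0 al k)%N.
Proof. by rewrite /mpsum big_nat_recr. Qed.

Lemma mdeg_mpsum (n : nat) (al : 'X_{1..n}) : mdeg al = mpsum al n.
Proof. by rewrite mdegE /mpsum big_mkord; apply: eq_bigr => i _; rewrite (mnm_nth 0%N). Qed.

(** The factorials of the partial sums telescope, leaving the reciprocal of a multinomial
    coefficient. *)
Lemma prod_gam (R : numFieldType) (n : nat) (al : 'X_{1..n}) :
  \prod_(k < n) gam R (mpsum al k) (nth 0%N al k) = (#|orderings al|%:R)^-1.
Proof.
have fn k : k`!%:R != 0 :> R by rewrite pnatr_eq0 -lt0n fact_gt0.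
have H N : \prod_(0 <= k < N) gam R (mpsum al k) (nth 0%N al k)
   = (\prod_(0 <= k < N) (nth 0%N al k)`!)%:R / (mpsum al N)`!%:R.
  elim: N => [|N IH]; first by rewrite mpsum0 !big_geq // fact0 divff ?oner_eq0.
  rewrite !big_nat_recr //= IH /gam mpsumS.
  by rewrite !natrM; field; rewrite !fn.
rewrite -(big_mkord xpredT (fun k => gam R (mpsum al k) (nth 0%N al k))) H -mdeg_mpsum.
rewrite big_mkord.
have -> : (\prod_(i < n) (nth 0 al i)`! = \prod_(i < n) (al i)`!)%N.
  by apply: eq_bigr => i _; rewrite (mnm_nth 0%N).
have E := card_orderings al.
have P0 : (\prod_(i < n) (al i)`!)%:R != 0 :> R.
  rewrite pnatr_eq0 -lt0n; apply: prodn_gt0 => i; exact: fact_gt0.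
have O0 : #|orderings al|%:R != 0 :> R.
  by apply: contraNneq (fn (mdeg al)) => O0; rewrite -E natrM O0 mul0r.
by rewrite -E natrM invfM mulrCA mulfV // mulr1.
Qed.

Lemma gam0l (F : numFieldType) (b : nat) : gam F 0 b = 1.
Proof. by rewrite /gam fact0 mul1n add0n divff // pnatr_eq0 -lt0n fact_gt0. Qed.

(** The point has coordinates [l] before index [k], [u] at [k] and 1 after it. This makes a
    two-variable multiplier in (partial sum, next exponent) a multiplier in [n] variables. *)
Lemma monomial_pullback (F : numDomainType) (n k : nat) (l u : F) :
  (k < n)%N -> `|l| <= 1 -> `|u| <= 1 -> exists x : 'I_n -> F,
     (forall i, `|x i| <= 1) /\
     (forall al : 'X_{1..n}, l ^+ mpsum al k * u ^+ nth 0%N al k = \prod_i x i ^+ al i).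
Proof.
move=> kn l1 u1.
pose chi (i : nat) : F := if (i < k)%N then l else if i == k then u else 1.
exists (fun i => chi i); split=> [i|al].
  by rewrite /chi; case: ifP => // _; case: ifP => // _; rewrite normr1.
under [RHS]eq_bigr do rewrite (mnm_nth 0%N).
rewrite -(big_mkord xpredT (fun i => chi i ^+ nth 0%N al i)) (big_cat_nat (leq0n _) (ltnW kn)) /=.
rewrite (big_ltn kn) [X in _ * (_ * X)]big_nat [X in _ * (_ * X)]big1 => [|i /andP[ki _]]; last first.
  by rewrite /chi ltnNge (ltnW ki) /= gtn_eqF // expr1n.
rewrite mulr1 {2}/chi ltnn eqxx; congr (_ * _).
rewrite /mpsum expr_sum big_nat [RHS]big_nat; apply: eq_bigr => i /andP[_ ik].
by rewrite /chi ik.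
Qed.

(** The multiplier of [sym_eval_le] is split as [rho^|al|], which evaluates [p] on radius [rho],
    times [r^|al|] times the product of [gam] factors, which the measures [m k] bound one variable
    at a time. *)
Lemma sym_eval_le_hull (R : realType) (n : nat) (B : nat -> R) (m : nat -> nat -> nat -> R[i])
    (r rho : R) :
  r * rho = 1 -> 0 <= rho ->
  (forall k, (k < n)%N -> 0 <= B k /\ char_hull (B k) (m k)) ->
  (forall al : 'X_{1..n}, \prod_(k < n) m k (mpsum al k) (nth 0%N al k)
     = (r%:C)%C ^+ mdeg al * \prod_(k < n) ((gam R (mpsum al k) (nth 0%N al k))%:C)%C) ->
  forall (V : lmodType R[i]) (ip : V -> V -> R[i]), is_hilbert ip ->
  forall T : 'I_n -> V -> V, (forall i, linear (T i)) ->
  (forall zeta : 'I_n -> R[i], (forall i, `|zeta i| <= 1) ->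
     forall x : V, hnorm ip (\sum_(i < n) zeta i *: T i x) <= hnorm ip x) ->
  forall (p : {mpoly R[i][n]}) (c : R),
  (forall z : 'I_n -> R[i], (forall i, `|z i| <= (rho%:C)%C) -> `|p.@[z]| <= (c%:C)%C) ->
  forall x : V, hnorm ip (sym_eval p T x) <= ((\prod_(k < n) B k * c)%:C)%C * hnorm ip x.
Proof.
move=> rr rho0 Hm Em V ip Hip T linT contrT p c pc; apply: sym_eval_le => // z z1.
pose q := mscale (fun al => (rho%:C)%C ^+ mdeg al) p.
have qE y : q.@[y] = p.@[fun i => (rho%:C)%C * y i].
  rewrite meval_mscale mevalE; apply: eq_bigr => al _; rewrite -mulrA; congr (_ * _).
  rewrite mdegE expr_sum -big_split /=; apply: eq_bigr => i _; exact/esym/exprMn.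
have qc y : (forall i, `|y i| <= 1) -> `|q.@[y]| <= (c%:C)%C.
  move=> y1; rewrite qE; apply: pc => i.
  by rewrite normrM norm_real_complex (ger0_norm rho0) ler_piMr ?ler0c.
have M : mult_norm_le (\prod_(k < n) B k)
    (fun al : 'X_{1..n} => \prod_(k < n) m k (mpsum al k) (nth 0%N al k)).
  apply: (mult_norm_le_prod (mu := fun k (al : 'X_{1..n}) => m k (mpsum al k) (nth 0%N al k))) => k kn.
  have [B0 Hk] := Hm k kn.
  by apply: (mult_norm_le_pullback Hk) => // l u l1 u1; apply: monomial_pullback.
have := M q c qc z z1; rewrite /q -mscaleM.
rewrite (@eq_mscale _ _ _ (fun al => (#|orderings al|%:R)^-1)) // => al.
rewrite Em mulrA -exprMn -rmorphM mulrC /= mulrC.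
rewrite (mulrC rho) rr rmorph1 expr1n mul1r -rmorph_prod prod_gam.
by rewrite fmorphV rmorph_nat.
Qed.

(** * The constants *)

(** Serves index 0, where the partial sum is empty and [gam 0 b = 1]. *)
Lemma char_hull1 (R : realType) : char_hull (1 : R) (fun _ _ => 1).
Proof.
apply: eq_char_hull (@char_hull_char R 1 1 _ _) => [a b||]; rewrite ?normr1 //.
by rewrite !expr1n mulr1.
Qed.

Lemma poly_bound_ge0 (R : realType) (n : nat) (p : {mpoly R[i][n]}) (rho c : R) : 0 <= rho ->
  (forall z : 'I_n -> R[i], (forall i, `|z i| <= (rho%:C)%C) -> `|p.@[z]| <= (c%:C)%C) -> 0 <= c.
Proof.
move=> rho0 pc; rewrite -ler0c; apply: le_trans (pc (fun=> 0) _) => // i.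
by rewrite normr0 ler0c.
Qed.

Lemma sym_bounds_of_hull (R : realType) (n : nat) (Bm Br : nat -> R)
    (m mr : nat -> nat -> nat -> R[i]) (r M rho : R) :
  r * rho = 1 -> 0 <= rho ->
  (forall k, (k < n)%N -> 0 <= Bm k /\ char_hull (Bm k) (m k)) ->
  (forall k, (k < n)%N -> 0 <= Br k /\ char_hull (Br k) (mr k)) ->
  (forall al : 'X_{1..n}, \prod_(k < n) m k (mpsum al k) (nth 0%N al k)
     = \prod_(k < n) ((gam R (mpsum al k) (nth 0%N al k))%:C)%C) ->
  (forall al : 'X_{1..n}, \prod_(k < n) mr k (mpsum al k) (nth 0%N al k)
     = (r%:C)%C ^+ mdeg al * \prod_(k < n) ((gam R (mpsum al k) (nth 0%N al k))%:C)%C) ->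
  \prod_(k < n) Bm k <= M -> \prod_(k < n) Br k <= 1 ->
  sym_bounds n M rho.
Proof.
move=> rr rho0 Hm Hr Em Er BM B1 V ip Hip T linT contrT p.
have mono (b d c : R) x y : 0 <= c -> b <= d ->
    hnorm ip x <= ((b * c)%:C)%C * hnorm ip y -> hnorm ip x <= ((d * c)%:C)%C * hnorm ip y.
  move=> c0 bd H; apply: le_trans H _; apply: ler_wpM2r.
    by case: Hip => _ _ ip0 _ _; rewrite /hnorm sqrtC_ge0.
  by rewrite lecR ler_wpM2r.
split=> c pc x.
  have c0 := poly_bound_ge0 rho0 pc; rewrite -[c]mul1r.
  by apply: mono c0 B1 _; apply: (sym_eval_le_hull rr rho0 Hr Er Hip linT contrT pc).
have pc1 : forall z : 'I_n -> R[i], (forall i, `|z i| <= ((1 : R)%:C)%C) -> `|p.@[z]| <= (c%:C)%C.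
  by move=> z z1; apply: pc.
apply: mono (poly_bound_ge0 ler01 pc1) BM _.
(* The bound on the unit polydisc is the undilated case [r = rho = 1]. *)
apply: (sym_eval_le_hull (mulr1 1) ler01 Hm _ Hip linT contrT pc1) => al.
by rewrite rmorph1 expr1n mul1r.
Qed.

Lemma char_hull_real_dilate (R : realType) (l u X Y X' Y' : R) :
  0 <= l <= 1 -> 0 <= u <= 1 -> X' = l * X -> Y' = u * Y ->
  char_hull 1 (fun a b => ((X ^+ a * Y ^+ b * gam R a b)%:C)%C) ->
  char_hull 1 (fun a b => ((X' ^+ a * Y' ^+ b * gam R a b)%:C)%C).
Proof.
move=> /andP[l0 l1] /andP[u0 u1] -> -> H.
apply: eq_char_hull (@char_hull_dilate R (l%:C)%C (u%:C)%C _ _ _ _ H) => [a b||].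
- by rewrite -!rmorphXn -!rmorphM /=; congr (_%:C)%C; rewrite !exprMn; ring.
- by rewrite norm_real_complex lecR ger0_norm.
- by rewrite norm_real_complex lecR ger0_norm.
Qed.

Lemma sym_bounds_exists (R : realType) (n : nat) :
  exists Mn Rn : R, 0 < Mn /\ 0 < Rn /\ sym_bounds n Mn Rn.
Proof.
pose x : R := 50%:R / 91%:R.
have x0 : 0 < x by rewrite /x; lra.
have x1 : x <= 1 by rewrite /x; lra.
exists (4 ^+ n), ((x ^+ n)^-1); split; first by rewrite exprn_gt0.
split; first by rewrite invr_gt0 exprn_gt0.
(* A new variable is dilated by [x^(k+1)], and the earlier ones, already at [x^k], by another [x].
   Thus all reach the common dilation [x^n]. *)
pose mr k a b : R[i] := ((x ^+ a * (x ^+ k.+1) ^+ b * gam R a b)%:C)%C.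
apply: (@sym_bounds_of_hull R n (fun=> 4) (fun=> 1) (fun k a b => ((gam R a b)%:C)%C) mr (x ^+ n)) => //.
- by rewrite mulfV // expf_neq0 // gt_eqF.
- by rewrite invr_ge0 exprn_ge0 // ltW.
- by move=> k _; split=> //; apply: gam_char_hull4.
- move=> k _; split=> //.
  apply: (@char_hull_real_dilate R 1 (x ^+ k) x x); rewrite ?ler01 ?lexx ?mul1r ?exprSr //.
    by rewrite exprn_ge0 ?exprn_ile1 // ltW.
  exact: gam_char_hull_symmetric.
- move=> al; rewrite /mr; under eq_bigr do rewrite rmorphM.
  rewrite big_split /=; congr (_ * _).
  have E N : \prod_(0 <= k < N) (x ^+ mpsum al k * (x ^+ k.+1) ^+ nth 0%N al k)
      = (x ^+ N) ^+ mpsum al N.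
    elim: N => [|N IH]; first by rewrite big_geq // mpsum0 expr0.
    by rewrite big_nat_recr //= IH mpsumS exprD exprS !exprMn; ring.
  rewrite -rmorph_prod -rmorphXn mdeg_mpsum -E big_mkord.
  by [].
- by rewrite prodr_const card_ord.
- by rewrite prodr_const card_ord expr1n.
Qed.

Lemma sym_bounds2 (R : realType) : @sym_bounds R 2 (41%:R / 10%:R) (185%:R / 100%:R).
Proof.
(* Only index 1 costs mass, so the product is 4, below 4.1. *)
pose B k : R := if k is 0%N then 1 else 4.
pose m k a b : R[i] := if k is 0%N then 1 else ((gam R a b)%:C)%C.
(* [r = 1 / 1.85] is [182/185] times the available dilation [50/91]. *)
pose r : R := 20%:R / 37%:R.
pose mr k a b : R[i] := if k is 0%N then 1 else ((r ^+ a * r ^+ b * gam R a b)%:C)%C.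
apply: (@sym_bounds_of_hull R 2 B (fun=> 1) m mr r).
- by rewrite /r; field.
- by lra.
- move=> [|k] _; split=> //=; [exact: char_hull1 | exact: gam_char_hull4].
- move=> [|k] _; split=> //=; first exact: char_hull1.
  apply: (@char_hull_real_dilate R (182%:R / 185%:R) (182%:R / 185%:R)
    (50%:R / 91%:R) (50%:R / 91%:R)); rewrite /r; try lra.
  exact: gam_char_hull_symmetric.
- by move=> al; rewrite !big_ord_recl !big_ord0 /= mpsum0 gam0l rmorph1.
- move=> al; rewrite mdeg_mpsum !big_ord_recl !big_ord0 /= /bump /= addn0.
  rewrite !mpsumS mpsum0 gam0l rmorph1 !mul1r !mulr1 !add0n /=.
  by rewrite -rmorphXn exprD [LHS]rmorphM.
- by rewrite !big_ord_recl big_ord0 /= mul1r mulr1; lra.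
- by rewrite !big_ord_recl big_ord0 !mulr1.
Qed.

Lemma sym_bounds3 (R : realType) : @sym_bounds R 3 (166%:R / 10%:R) (26%:R / 10%:R).
Proof.
(* Indices 1 and 2 cost 4 each: [16 <= 16.6]. *)
pose B k : R := if k is 0%N then 1 else 4.
pose m k a b : R[i] := if k is 0%N then 1 else ((gam R a b)%:C)%C.
(* The first two variables are dilated by [x], then by [X]; the third by [Y]. As
   [x X = Y = 1 / 2.6], all three end at the same dilation. *)
pose x : R := 50%:R / 91%:R; pose X : R := 7%:R / 10%:R; pose Y : R := 5%:R / 13%:R.
pose mr k a b : R[i] := match k with 0%N => 1
  | 1%N => ((x ^+ a * x ^+ b * gam R a b)%:C)%C
  | _ => ((X ^+ a * Y ^+ b * gam R a b)%:C)%C end.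
apply: (@sym_bounds_of_hull R 3 B (fun=> 1) m mr Y).
- by rewrite /Y; field.
- by lra.
- move=> [|k] _; split=> //=; [exact: char_hull1 | exact: gam_char_hull4].
- move=> [|[|k]] _; split=> //=; first exact: char_hull1.
    exact: gam_char_hull_symmetric.
  exact: gam_char_hull_asymmetric.
- by move=> al; rewrite !big_ord_recl !big_ord0 /= mpsum0 gam0l rmorph1.
- move=> al; rewrite mdeg_mpsum !big_ord_recl !big_ord0 /= /bump /= addn0.
  rewrite !mpsumS mpsum0 gam0l rmorph1 !mul1r !mulr1 !add0n /=.
  rewrite -rmorphXn -!rmorphM; congr (_%:C)%C.
  set A := nth _ _ 0; set A1 := nth _ _ 1; set A2 := nth _ _ 2.
  have E k : Y ^+ k = x ^+ k * X ^+ k by rewrite -exprMn; congr (_ ^+ _); rewrite /Y /x /X; field.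
  by rewrite !(exprD Y) (E A) (E A1) !(exprD X); ring.
- by rewrite !big_ord_recl big_ord0 /= mul1r mulr1; lra.
- by rewrite !big_ord_recl big_ord0 !mulr1.
Qed.

Theorem theorem4p6 (R : realType) :
  (forall n : nat, exists Mn Rn : R, 0 < Mn /\ 0 < Rn /\ sym_bounds n Mn Rn) /\
  @sym_bounds R 2 (41%:R / 10%:R) (185%:R / 100%:R) /\
  @sym_bounds R 3 (166%:R / 10%:R) (26%:R / 10%:R).
Proof.
split; first exact: sym_bounds_exists.
split; [exact: sym_bounds2 | exact: sym_bounds3].
Qed.
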